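(* Let $D$ be a strongly connected digraph on $n\geq 4$ vertices satisfying the following condition: for every triple $x,y,z$ of vertices of $D$ such that $x$ and $y$ are non-adjacent, if there is no arc from $x$ to $z$ then $d(x)+d(y)+d^+(x)+d^-(z)\geq 3n-2$, and if there is no arc from $z$ to $x$ then $d(x)+d(y)+d^-(x)+d^+(z)\geq 3n-2$. Then either $D$ contains a cycle of length $n-1$ (a pre-Hamiltonian cycle), or $n$ is even and $D$ is isomorphic to the complete bipartite digraph $K^*_{n/2,n/2}$.
   Context: Digraphs are finite, without loops and without multiple arcs. For a vertex $x$, $d^+(x)$ is the number of vertices $y$ with an arc $xy$ (out-degree), $d^-(x)$ is the number of vertices $y$ with an arc $yx$ (in-degree), and $d(x)=d^+(x)+d^-(x)$. Two distinct vertices $x,y$ are adjacent if $xy$ or $yx$ (or both) is an arc. A digraph is strongly connected if for every ordered pair of distinct vertices $x,y$ there is a directed path from $x$ to $y$. A cycle means a directed cycle. $K^*_{p,q}$ denotes the symmetric digraph obtained from the complete bipartite graph $K_{p,q}$ (partite sets of sizes $p$ and $q$) by replacing each edge $xy$ with the two arcs $xy$ and $yx$. *)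

(* Defs.v *)
From mathcomp Require Import all_boot.

Set Implicit Arguments.
Unset Strict Implicit.
Unset Printing Implicit Defensive.

(* A digraph without multiple arcs on the vertex type V is its arc relation
   D : rel V; looplessness is the separate hypothesis [irreflexive D]. *)

Section Digraph.

Variables (V : finType) (D : rel V).

Definition outdeg (x : V) : nat := #|[set y | D x y]|.

Definition indeg (x : V) : nat := #|[set y | D y x]|.

Definition deg (x : V) : nat := outdeg x + indeg x.

Definition adjacent (x y : V) : bool := (x != y) && (D x y || D y x).

Definition nonadjacent (x y : V) : bool := (x != y) && ~~ adjacent x y.

Definition strongly_connected : Prop :=
  forall x y : V, x != y -> connect D x y.

(* [ucycle] alone also accepts the empty sequence (and, on a loop, a singleton),
   so this is a directed cycle of length k only for k >= 2, D being loopless. *)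
Definition has_cycle_of_length (k : nat) : Prop :=
  exists c : seq V, ucycle D c /\ size c = k.

(* A triple consists of three pairwise distinct vertices: allowing z = x or
   z = y would already force d(x) + d(y) >= 2|V| - 1 for all non-adjacent
   x, y, i.e. Meyniel's condition. *)
Definition triple_degree_condition : Prop :=
  forall x y z : V, uniq [:: x; y; z] -> nonadjacent x y ->
    (~~ D x z -> deg x + deg y + outdeg x + indeg z >= 3 * #|V| - 2) /\
    (~~ D z x -> deg x + deg y + indeg x + outdeg z >= 3 * #|V| - 2).

End Digraph.

Definition digraph_iso (V W : finType) (D : rel V) (E : rel W) : Prop :=
  exists f : V -> W, bijective f /\ (forall x y, E (f x) (f y) = D x y).

Definition Kstar (p q : nat) : rel ('I_p + 'I_q)%type :=
  fun u v =>
    match u, v with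
    | inl _, inr _ | inr _, inl _ => true
    | inl _, inl _ | inr _, inr _ => false
    end.

(* Main.v *)
Require Import Defs.
From mathcomp Require Import all_boot.
From mathcomp Require Import zify.

(** Assume that there is no cycle of length n - 1 and call a non-adjacent pair
bad if its degree sum is at most 2n - 2. Adding up the conditions for two
non-adjacent pairs {x, y} and {x, z} shows that bad pairs are disjoint; moreover
if {x, y} is bad and z is not an out-neighbour of x, then
d^+(x) + d^-(z) >= n. Take a longest cycle C of length m <= n - 2.

In the style of Bondy and Thomassen's proof of Meyniel's theorem, consider a
detour that leaves C, runs outside C and comes back after skipping some vertices
of C. The skipped vertices are inserted one by one into the rest of C; as no
cycle has length strictly between m and n, some of them get stuck, and a stuck
vertex together with a vertex of the detour has degree sum at most 2n - 2 unless
the two are joined by short paths outside C.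

If m <= n - 3, a detour skipping as few vertices as possible thus yields either
two bad pairs with a common vertex, or one bad pair {u, v} such that u and v can
be exchanged on C; the inequalities for {u, v} and the remaining outside
vertices are then contradictory.

If m = n - 2, let v, w be the vertices outside C. They are joined by arcs in both
directions and every detour through v alone skips exactly one vertex u. Either u
or v has degree n, which forces its neighbours to alternate on C and makes D a
balanced complete bipartite digraph, or {u, v} is bad, the neighbourhoods of u
and v on C are monotone, and a crossing argument gives a cycle of length n - 1. *)

(** A Hamiltonian cycle is not excluded by the assumption, and this obstacle shapes the proof: [C]
    is longest only among the cycles of length at most [n - 2], and a rerouting contradicts nothing
    unless it leaves out at least one vertex. Hence the vertex given up in most constructions, and
    the special case [n = m + 3], where a detour may use up all the outside vertices. The bound
    [2n - 2] is chosen because [3n - 2] exceeds it by exactly [n]. The resulting inequalities clash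
    with a count on the cycle: if an outside path can replace one cycle vertex and create a
    forbidden length, then the in-degree of its start plus the out-degree of its end, both taken on
    the cycle, is at most the length of the cycle. *)

Set Implicit Arguments.
Unset Strict Implicit.
Unset Printing Implicit Defensive.

(** * Counting neighbours along sequences *)

Ltac perm_lia :=
  let a := fresh "a" in apply/permP => a;
  repeat match goal with
    H : is_true (perm_eq _ _) |- _ => generalize (elimT permP H a); clear H end;
  clear; rewrite -?cats1 /=; rewrite ?count_cat /=; rewrite ?count_cat /=;
  rewrite ?count_cat /=; lia.

(* [size] may occur both at [Equality.sort V] and at [Finite.sort V], which [lia]
   does not identify. *)
Ltac vlia :=
  repeat match goal with
  | H : is_true (leq _ _) |- _ => revert H
  | H : is_true (~~ leq _ _) |- _ => revert H
  | H : @eq nat _ _ |- _ => revert H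
  end; clear; intros;
  repeat match goal with
  | H : context [Equality.sort (fintype_Finite__to__eqtype_Equality ?E)] |- _ =>
    progress change (Equality.sort (fintype_Finite__to__eqtype_Equality E))
      with (Finite.sort E) in H
  | |- context [Equality.sort (fintype_Finite__to__eqtype_Equality ?E)] =>
    progress change (Equality.sort (fintype_Finite__to__eqtype_Equality E))
      with (Finite.sort E)
  end; lia.

Section Counting.

Variables (V : finType) (D : rel V).
Hypothesis D_loopless : irreflexive D.

(** Degrees are taken relative to sequences because paths, leftovers and outside vertices are pieces
    of one spanning list, over which the degree in [D] is a sum. *)
Definition oc (z : V) (s : seq V) : nat := count (D z) s.
Definition ic (z : V) (s : seq V) : nat := count (fun y => D y z) s.
Definition dg (z : V) (s : seq V) : nat := oc z s + ic z s.
Definition ac (x y : V) : nat := D x y + D y x.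

Definition spanning (s : seq V) : bool := perm_eq s (enum V).

Lemma psize (s t : seq V) : perm_eq s t -> size s = size t.
Proof. exact: perm_size. Qed.

Lemma oc_perm z s t : perm_eq s t -> oc z s = oc z t.
Proof. by move/permP; apply. Qed.

Lemma ic_perm z s t : perm_eq s t -> ic z s = ic z t.
Proof. by move/permP; apply. Qed.

Lemma dg_perm z s t : perm_eq s t -> dg z s = dg z t.
Proof. by move=> st; rewrite /dg (oc_perm z st) (ic_perm z st). Qed.

Lemma oc_cat z s t : oc z (s ++ t) = oc z s + oc z t.
Proof. exact: count_cat. Qed.

Lemma ic_cat z s t : ic z (s ++ t) = ic z s + ic z t.
Proof. exact: count_cat. Qed.

Lemma dg_cat z s t : dg z (s ++ t) = dg z s + dg z t.
Proof. by rewrite /dg oc_cat ic_cat; lia. Qed.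

Lemma oc_cons z x s : oc z (x :: s) = D z x + oc z s.
Proof. by []. Qed.

Lemma ic_cons z x s : ic z (x :: s) = D x z + ic z s.
Proof. by []. Qed.

Lemma dg_cons z x s : dg z (x :: s) = ac z x + dg z s.
Proof. by rewrite /dg /ac oc_cons ic_cons; lia. Qed.

Lemma dg_nil z : dg z [::] = 0. Proof. by []. Qed.

Lemma oc_le z s : oc z s <= size s. Proof. exact: count_size. Qed.
Lemma ic_le z s : ic z s <= size s. Proof. exact: count_size. Qed.

Lemma dg_le z s : dg z s <= 2 * size s.
Proof. by have := oc_le z s; have := ic_le z s; rewrite /dg; lia. Qed.

Lemma ac_le x y : ac x y <= 2.
Proof. by rewrite /ac; case: (D x y); case: (D y x). Qed.

Lemma acC x y : ac x y = ac y x.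
Proof. exact: addnC. Qed.

Lemma acxx x : ac x x = 0.
Proof. by rewrite /ac D_loopless. Qed.

Lemma perm_to z (s : seq V) : z \in s -> exists s' : seq V, perm_eq s (z :: s').
Proof. by move=> zs; exists (rem z s); apply: perm_to_rem. Qed.

Lemma dg_mem_le z s : z \in s -> dg z s <= 2 * (size s).-1.
Proof.
move=> /perm_to [s' ps]; rewrite (dg_perm z ps) (psize ps) dg_cons acxx.
exact: dg_le.
Qed.

Lemma oc_mem_le z y s : y \in s -> ~~ D z y -> oc z s <= (size s).-1.
Proof.
move=> /perm_to [s' ps] nzy; rewrite (oc_perm z ps) (psize ps) oc_cons.
by rewrite (negbTE nzy) add0n oc_le.
Qed.

Lemma oc_gt0P z s : reflect (exists2 y, y \in s & D z y) (0 < oc z s).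
Proof. by rewrite -has_count; apply: hasP. Qed.

Lemma ic_gt0P z s : reflect (exists2 y, y \in s & D y z) (0 < ic z s).
Proof. by rewrite -has_count; apply: hasP. Qed.

Lemma dg0 z s : (forall y, y \in s -> ac z y = 0) -> dg z s = 0.
Proof.
elim: s => // y s IHs Hs; rewrite dg_cons Hs ?mem_head // IHs // => u us.
by apply: Hs; rewrite inE us orbT.
Qed.

Lemma spanning_size s : spanning s -> size s = #|V|.
Proof. by move/psize->; rewrite cardE. Qed.

Lemma spanning_uniq s : spanning s -> uniq s.
Proof. by move/perm_uniq->; rewrite enum_uniq. Qed.

Lemma spanning_mem s x : spanning s -> x \in s.
Proof. by move/perm_mem->; rewrite mem_enum. Qed.

Lemma spanningP s : uniq s -> size s = #|V| -> spanning s.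
Proof.
move=> us ss; apply: uniq_perm; rewrite ?enum_uniq //.
have sub : {subset s <= enum V} by move=> y _; rewrite mem_enum.
by have [] := uniq_min_size us sub; rewrite ?ss ?cardE.
Qed.

Lemma spanning_complement s : uniq s ->
  exists t, [/\ spanning (s ++ t), uniq t & forall x, (x \in t) = (x \notin s)].
Proof.
move=> us; pose t := [seq x <- enum V | x \notin s].
have ut : uniq t by apply: filter_uniq; apply: enum_uniq.
have mt x : (x \in t) = (x \notin s) by rewrite mem_filter mem_enum andbT.
exists t; split => //; apply: uniq_perm; rewrite ?enum_uniq //.
  rewrite cat_uniq us ut andbT; apply/hasPn => x.
  by rewrite mt.
by move=> x; rewrite mem_cat mt mem_enum orbN.
Qed.

Lemma outdegE z s : spanning s -> outdeg D z = oc z s.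
Proof.
move=> /oc_perm->; rewrite /oc /outdeg cardE -size_filter.
apply: perm_size; apply: uniq_perm; rewrite ?enum_uniq //.
  by apply: filter_uniq; apply: enum_uniq.
by move=> y; rewrite [LHS]mem_enum [RHS]mem_filter mem_enum !inE andbT.
Qed.

Lemma indegE z s : spanning s -> indeg D z = ic z s.
Proof.
move=> /ic_perm->; rewrite /ic /indeg cardE -size_filter.
apply: perm_size; apply: uniq_perm; rewrite ?enum_uniq //.
  by apply: filter_uniq; apply: enum_uniq.
by move=> y; rewrite [LHS]mem_enum [RHS]mem_filter mem_enum !inE andbT.
Qed.

Lemma degE z s : spanning s -> deg D z = dg z s.
Proof. by move=> fs; rewrite /deg (outdegE z fs) (indegE z fs). Qed.

(** Pigeonhole over the [size s] consecutive pairs of [x :: s]: [belast x s] lists their left ends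
    and [s] their right ends. *)
Lemma consecutive_pair (A B : pred V) x s :
    size s < count A (belast x s) + count B s ->
  exists s1 p q s2, [/\ x :: s = s1 ++ [:: p, q & s2], A p & B q].
Proof.
elim: s x => //= y s IHs x H.
have [/andP[Ax By]|nAB] := boolP (A x && B y); first by exists [::], x, y, s.
case: (IHs y); first by move: H nAB; case: (A x); case: (B y) => //=; lia.
by move=> s1 [p [q [s2 [-> Ap Bq]]]]; exists (x :: s1), p, q, s2.
Qed.

Lemma split_last2 (s : seq V) : 2 <= size s -> exists s' y z, s = s' ++ [:: y; z].
Proof.
case/lastP: s => // s z; case/lastP: s => // s y _.
by exists s, y, z; rewrite -!cats1 -catA.
Qed.

Lemma subset_size_perm (s t : seq V) : uniq s -> uniq t -> {subset s <= t} ->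
  size t <= size s -> perm_eq s t.
Proof.
by move=> us ut sub le; apply: uniq_perm => //; case: (uniq_min_size us sub le).
Qed.

Lemma split_last_has (A : pred V) s : has A s ->
  exists s1 y s2, [/\ s = s1 ++ y :: s2, A y & {in s2, forall z, ~~ A z}].
Proof.
elim: s => //= x s IHs; case: (boolP (has A s)) => [/IHs|nA].
  by case=> s1 [y [s2 [-> Ay As2]]] _; exists (x :: s1), y, s2.
by rewrite orbF => Ax; exists [::], x, s; split=> // z; apply/hasPn.
Qed.

Lemma cat_eq_split (s1 t1 s2 t2 : seq V) : s1 ++ t1 = s2 ++ t2 ->
  size s1 <= size s2 -> exists B, s2 = s1 ++ B /\ t1 = B ++ t2.
Proof.
elim: s1 s2 => [|x s1 IHs] [|y s2] //=; rewrite ?ltnS.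
- by move=> -> _; exists [::].
- by move=> -> _; exists (y :: s2).
case=> -> E le; case: (IHs _ E le) => B [-> ->]; by exists B.
Qed.

Lemma card_spanning (p : pred V) s : spanning s -> #|[set y | p y]| = count p s.
Proof.
move=> /permP->; rewrite cardE -size_filter.
apply: perm_size; apply: uniq_perm; rewrite ?enum_uniq //.
  by apply: filter_uniq; apply: enum_uniq.
by move=> y; rewrite [LHS]mem_enum [RHS]mem_filter mem_enum !inE andbT.
Qed.

Lemma split_first_has (A : pred V) s : has A s ->
  exists s1 y s2, [/\ s = s1 ++ y :: s2, A y & {in s1, forall z, ~~ A z}].
Proof.
elim: s => //= x s IHs; have [Ax _|nA /IHs] := boolP (A x).
  by exists [::], x, s.
case=> s1 [y [s2 [-> Ay As1]]]; exists (x :: s1), y, s2; split=> // z.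
by rewrite inE => /orP[/eqP->|/As1].
Qed.

End Counting.

(** * Insertions into paths and cycles *)

Section Cycles.

Variables (V : finType) (D : rel V).
Hypothesis D_loopless : irreflexive D.

Local Notation oc := (oc D).
Local Notation ic := (ic D).
Local Notation dg := (dg D).
Local Notation ac := (ac D).

Definition no_cycle k := forall c : seq V, uniq c -> cycle D c -> size c <> k.

Lemma cycle_catE r P Q :
  cycle D (r :: P ++ Q) = path D r P && path D (last r P) (rcons Q r).
Proof. by rewrite /= rcons_cat cat_path. Qed.

(** A path arc [p -> q] has room for [z] unless [p -> z] or [z -> q] is absent. Summing over the
    [size P] arcs counts all arcs at [z] except [z -> r] and the one from the last vertex to [z],
    whence the two corrections. *)
Lemma insert_path z r P :
    path D r P -> size P + D z r + D (last r P) z < dg z (r :: P) ->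
  exists P', [/\ path D r P', last r P' = last r P & perm_eq P' (z :: P)].
Proof.
elim: P r => [|y P IHP] r /=.
  by move=> _; rewrite dg_cons /ac /dg /=; lia.
move=> /andP[ry yP]; rewrite dg_cons => H.
have [/andP[rz zy]|nrzy] := boolP (D r z && D z y).
  by exists (z :: y :: P); rewrite /= rz zy yP.
case: (IHP y yP).
  by move: H nrzy; rewrite /ac; case: (D r z); case: (D z y) => //=; lia.
move=> P' [yP' lP' pP']; exists (y :: P'); split=> //=; first by rewrite ry.
perm_lia.
Qed.

(** Insertion keeps both ends of the path, so it can be repeated. It halts with exactly [k] vertices
    left, a number picked by the caller to hit a forbidden cycle length, or because [insert_path]
    fails for everything that remains. *)
Lemma greedy_insertion r (P X : seq V) k :
    path D r P -> k <= size X ->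
  exists P' X' : seq V, [/\ path D r P', last r P' = last r P,
    perm_eq (P' ++ X') (P ++ X), k <= size X' <= size X /\ {subset X' <= X} &
    size X' = k \/
    forall g, g \in X' -> dg g (r :: P') <= size P' + D g r + D (last r P) g].
Proof.
move: {2}(size X) (leqnn (size X)) => N.
elim: N P X => [|N IHN] P X sX rP kX;
  have kXX : k <= size X <= size X /\ {subset X <= X} by split=> //; rewrite kX leqnn.
  by exists P, X; split=> //; left; lia.
have [/eqP sXk|sXk] := boolP (size X == k); first by exists P, X; split=> //; left.
have [/hasP[g gX]|] :=
  boolP (has (fun g => size P + D g r + D (last r P) g < dg g (r :: P)) X).
  move=> /(insert_path rP) [P1 [rP1 lP1 pP1]].
  have [X1 pX1] := perm_to gX.
  have s1 : size X = (size X1).+1 by rewrite (psize pX1).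
  case: (IHN P1 X1) => //; [lia|lia|].
  move=> P' [X' [rP' lP' pP' [kX' sX'] H]]; exists P', X'; split=> //.
  - by rewrite lP'.
  - perm_lia.
  - by split=> [|y /sX' yX1]; [lia|]; rewrite (perm_mem pX1) inE yX1 orbT.
  - by rewrite -lP1.
move/hasPn=> H; exists P, X; split=> //; right=> g gX.
by rewrite leqNgt H.
Qed.

Lemma perm_map_next (c : seq V) : uniq c -> perm_eq (map (next c) c) c.
Proof.
move=> uc; have inj := can_inj (prev_next uc).
apply: uniq_perm => // [|x]; first by rewrite map_inj_uniq.
apply/mapP/idP => [[y yc ->]|xc]; first by rewrite mem_next.
by exists (prev c x); rewrite ?mem_prev ?next_prev.
Qed.

Lemma count_next (c : seq V) (B : pred V) : uniq c ->
  count (fun x => B (next c x)) c = count B c.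
Proof.
move=> uc; rewrite -[RHS](permP (perm_map_next uc)) count_map.
exact: eq_count.
Qed.

Lemma count_disjoint (A B : pred V) (c : seq V) :
  {in c, forall x, ~~ (A x && B x)} -> count A c + count B c <= size c.
Proof.
move=> H; rewrite -count_predUI.
have -> : count (predI A B) c = 0.
  by apply/eqP; rewrite -leqn0 leqNgt -has_count; apply/hasPn => x /H.
by rewrite addn0 count_size.
Qed.

Lemma cycle_insert (c : seq V) x v :
    uniq c -> cycle D c -> x \in c -> v \notin c ->
    D x v -> D v (next c x) ->
  exists c' : seq V, [/\ uniq c', cycle D c' & perm_eq c' (v :: c)].
Proof.
move=> uc cc xc vc xv; case: (rot_to xc) => i s E.
rewrite -(next_rot i uc) E => vy.
have pE : perm_eq (x :: s) c by rewrite -E perm_rot.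
exists (x :: v :: s); split.
- have := perm_uniq pE; rewrite uc /= => /andP[xs us].
  move: vc; rewrite -(perm_mem pE) inE negb_or => /andP[vx vs].
  by rewrite inE negb_or eq_sym vx xs vs us.
- move: cc; rewrite -(rot_cycle i) E.
  case: s {E pE} vy => [|y s] /=; rewrite ?eqxx ?xv => -> //=.
  by move=> /andP[].
- perm_lia.
Qed.

(** The detour [q :: Q] takes the place of the successor of [x], so the length grows by [size Q]
    only. On a 2-cycle the second successor is [x] itself. *)
Lemma cycle_skip (c : seq V) x q (Q : seq V) :
    uniq c -> cycle D c -> 1 < size c -> x \in c -> uniq (q :: Q) ->
    {in q :: Q, forall y, y \notin c} ->
    D x q -> path D q Q -> D (last q Q) (next c (next c x)) ->
  exists c' : seq V, [/\ uniq c', cycle D c' & size c' = size c + size Q].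
Proof.
move=> uc cc sc xc uQ dQ xq qQ; case: (rot_to xc) => i s E.
rewrite -!(next_rot i uc) E => lz.
have pE : perm_eq (x :: s) c by rewrite -E perm_rot.
have sz := psize pE.
case: s sz E pE lz => [|y s] sz E pE lz; first by rewrite /= in sz; vlia.
have := perm_uniq pE; rewrite uc /= inE negb_or => /andP[/andP[xy xs] /andP[ys us]].
have dQ' z : z \in q :: Q -> z \notin [:: x, y & s].
  by move=> /dQ; rewrite (perm_mem pE).
move: lz; rewrite /= eqxx [y == x]eq_sym (negbTE xy) => lz.
exists (x :: (q :: Q) ++ s); split.
- rewrite cons_uniq mem_cat negb_or xs andbT cat_uniq uQ us andbT.
  apply/andP; split.
    by apply: contraL (mem_head x (y :: s)) => /dQ'.
  apply/hasPn => z zs; apply/negP => /dQ'.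
  by rewrite !inE zs !orbT.
- move: cc; rewrite -(rot_cycle i) E /=.
  rewrite rcons_cat cat_path xq qQ /=.
  case: s {E pE sz xs ys us dQ'} lz => [|z s] /=.
    by rewrite eqxx => ->.
  rewrite eqxx => -> /=.
  by move=> /and3P[].
- by rewrite /= size_cat; move: sz => /=; vlia.
Qed.

(** The in-neighbours of [v] and the predecessors of its out-neighbours are disjoint: a common
    vertex would leave room for [v] right after it. *)
Lemma insert_bound (c : seq V) v :
    uniq c -> cycle D c -> v \notin c -> no_cycle (size c).+1 ->
  dg v c <= size c.
Proof.
move=> uc cc vc nc; rewrite /dg addnC /ic /oc -(count_next (D v) uc).
apply: count_disjoint => x xc; apply/negP => /andP[xv vx].
have [c' [uc' cc' pc']] := cycle_insert uc cc xc vc xv vx.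
by apply: (nc c') => //; rewrite (psize pc').
Qed.

(** The count of [insert_bound] shifted one place further, since the detour now replaces a cycle
    vertex; hence [count_next] is applied twice. *)
Lemma skip_bound (c : seq V) q (Q : seq V) :
    uniq c -> cycle D c -> 1 < size c -> uniq (q :: Q) ->
    {in q :: Q, forall y, y \notin c} -> path D q Q ->
    no_cycle (size c + size Q) ->
  ic q c + oc (last q Q) c <= size c.
Proof.
move=> uc cc sc uQ dQ qQ nc.
rewrite /ic /oc -(count_next (D (last q Q)) uc).
rewrite -(count_next (fun x => D (last q Q) (next c x)) uc).
apply: count_disjoint => x xc; apply/negP => /andP[xq lx].
have [c' [uc' cc' pc']] := cycle_skip uc cc sc xc uQ dQ xq qQ lx.
by apply: (nc c').
Qed.

Lemma next_mid (p q : seq V) y b :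
  uniq (p ++ [:: y, b & q]) -> next (p ++ [:: y, b & q]) y = b.
Proof. by move=> u; rewrite -(next_rot (size p) u) rot_size_cat /= eqxx. Qed.

Lemma prev_head z (s : seq V) : uniq (z :: s) -> prev (z :: s) z = last z s.
Proof.
move=> u; apply: (can_inj (prev_next u)); rewrite next_prev //.
case/lastP: s u => [|s y] u; first by rewrite /= eqxx.
rewrite last_rcons -(next_rot (size (z :: s)) u) -cats1 -cat_cons.
by rewrite rot_size_cat /= eqxx.
Qed.

Lemma next_closed (S : pred V) (c : seq V) z : uniq c -> z \in c -> S z ->
  {in c, forall x, S x -> S (next c x)} -> {in c, forall x, S x}.
Proof.
move=> uc zc Sz H x; rewrite -(fconnect_cycle (cycle_next uc) zc) => /iter_findex <-.
suff [] : S (iter (findex (next c) z x) (next c) z) /\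
    iter (findex (next c) z x) (next c) z \in c by [].
elim: (findex _ _ _) => //= k [Sk kc]; split; first exact: H.
by rewrite mem_next.
Qed.

Lemma stuck_dg (c : seq V) r (P' X' Y : seq V) g : uniq c ->
    perm_eq (r :: P' ++ X' ++ Y) c -> g \in X' ->
    dg g (r :: P') <= size P' + 2 ->
  dg g c + 1 <= size P' + 1 + 2 * (size X' + size Y).
Proof.
move=> uc pc gX le; rewrite -(dg_perm D g pc) -cat_cons dg_cat.
have := @dg_mem_le _ D D_loopless g (X' ++ Y); rewrite mem_cat gX size_cat.
have : 0 < size X' by case: X' gX {pc}.
by move=> ? /(_ isT); vlia.
Qed.

End Cycles.

(** * Bad pairs *)

Ltac span_lia := unfold spanning in *; perm_lia.

Ltac split_ands :=
  repeat match goal with H : is_true (_ && _) |- _ =>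
    let a := fresh "H" in let b := fresh "H" in case/andP: H => a b end.

Ltac path_tac :=
  rewrite -?cats1; do 6! [rewrite -?catA ?cat_path ?last_cat /=];
  intros; split_ands; repeat (apply/andP; split); by [].

Section BadPairs.

Variables (V : finType) (D : rel V).

Local Notation oc := (oc D).
Local Notation ic := (ic D).
Local Notation dg := (dg D).
Local Notation ac := (ac D).
Local Notation na := (nonadjacent D).
Local Notation n := #|V|.

Hypothesis D_loopless : irreflexive D.

Lemma naE x y : na x y = [&& x != y, ~~ D x y & ~~ D y x].
Proof. by rewrite /nonadjacent /adjacent negb_and negb_or; case: (x == y). Qed.

Lemma naC x y : na x y = na y x.
Proof. by rewrite !naE eq_sym; congr andb; exact: andbC. Qed.

Lemma na_ac x y : na x y -> ac x y = 0.
Proof. by rewrite naE /ac => /and3P[_ /negbTE-> /negbTE->]. Qed.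

Lemma ac_na x y : x != y -> ac x y = 0 -> na x y.
Proof. by rewrite naE /ac => ->; case: (D x y); case: (D y x). Qed.

Hypothesis D_cond : triple_degree_condition D.

Lemma cond_out x y z : na x y -> z != x -> z != y -> ~~ D x z ->
  3 * n <= deg D x + deg D y + outdeg D x + indeg D z + 2.
Proof.
move=> nxy zx zy nxz; have xy : x != y by case/andP: nxy.
have [] := D_cond (x := x) (y := y) (z := z) => //.
  by rewrite /= !inE negb_or xy eq_sym zx eq_sym zy.
by move=> /(_ nxz) H _; vlia.
Qed.

Lemma cond_in x y z : na x y -> z != x -> z != y -> ~~ D z x ->
  3 * n <= deg D x + deg D y + indeg D x + outdeg D z + 2.
Proof.
move=> nxy zx zy nxz; have xy : x != y by case/andP: nxy.
have [] := D_cond (x := x) (y := y) (z := z) => //.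
  by rewrite /= !inE negb_or xy eq_sym zx eq_sym zy.
by move=> _ /(_ nxz) H; vlia.
Qed.

Definition bad x y := na x y && (deg D x + deg D y + 2 <= 2 * n).

Lemma badC x y : bad x y = bad y x.
Proof. by rewrite /bad naC [deg D x + _]addnC. Qed.

Lemma bad_out x y z : bad x y -> z != x -> z != y -> ~~ D x z ->
  n <= outdeg D x + indeg D z.
Proof. by move=> /andP[nxy S] zx zy nxz; have := cond_out nxy zx zy nxz; vlia. Qed.

Lemma bad_in x y z : bad x y -> z != x -> z != y -> ~~ D z x ->
  n <= indeg D x + outdeg D z.
Proof. by move=> /andP[nxy S] zx zy nxz; have := cond_in nxy zx zy nxz; vlia. Qed.

(** Both arcs between [x] and [z] are absent, so the out- and the in-inequality of the bad pair
    apply and add up to degrees. *)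
Lemma bad_na x y z : bad x y -> na x z -> z != y -> 2 * n <= deg D x + deg D z.
Proof.
move=> bxy; rewrite naE eq_sym => /and3P[zx xz zx'] zy.
have := bad_out bxy zx zy xz; have := bad_in bxy zx zy zx'.
by rewrite /deg; vlia.
Qed.

Lemma bad_unique x y z : bad x y -> bad x z -> z = y.
Proof.
move=> bxy bxz; apply/eqP; apply: contraT => zy.
by case/andP: bxz => nxz S; have := bad_na bxy nxz zy; vlia.
Qed.

Hypothesis D_strong : strongly_connected D.

Lemma exit_arc (S : pred V) x y : S x -> ~~ S y ->
  exists a b, [/\ S a, ~~ S b & D a b].
Proof.
move=> Sx Sy; have xy : x != y by apply: contraNneq Sy => <-.
have /connectP[p xp] := D_strong xy.
elim: p x Sx {xy} xp => [|z p IHp] x Sx /= => [_ E|/andP[xz zp] E].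
  by rewrite E Sx in Sy.
have [Sz|Sz] := boolP (S z); last by exists x, z.
exact: IHp Sz zp E.
Qed.

End BadPairs.

(** * Cycles missing two vertices *)

Section TwoOutside.

Variables (V : finType) (D : rel V).

Local Notation oc := (oc D).
Local Notation ic := (ic D).
Local Notation dg := (dg D).
Local Notation ac := (ac D).
Local Notation na := (nonadjacent D).
Local Notation n := #|V|.

Hypothesis D_loopless : irreflexive D.
Hypothesis D_cond : triple_degree_condition D.
Hypothesis D_strong : strongly_connected D.
Hypothesis n_ge4 : 4 <= n.
Hypothesis no_pre : no_cycle D n.-1.

(** The form in which most contradictions of this section arise; [z] is the vertex given up. The
    cycle is cut after [r :: P] because [P] often comes from insertion, where only its ends and its
    vertex set are known. *)
Lemma no_almost_spanning r P Q z :
    path D r P -> path D (last r P) (rcons Q r) ->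
  spanning (z :: r :: P ++ Q) -> False.
Proof.
move=> rP rQ sp; apply: (no_pre (c := r :: P ++ Q)).
- by have := spanning_uniq sp => /andP[].
- by rewrite cycle_catE rP rQ.
- by have := spanning_size sp => /=; vlia.
Qed.

Definition misses (c : seq V) v w := cycle D c /\ spanning [:: v, w & c].

Lemma missesC c v w : misses c v w -> misses c w v.
Proof. by case=> cc sp; split=> //; span_lia. Qed.

Lemma missesP c v w : misses c v w ->
  [/\ uniq c, v \notin c, w \notin c, v != w & size c + 2 = n].
Proof.
case=> _ sp; have := spanning_uniq sp; have := spanning_size sp.
rewrite /= inE negb_or => sz /and3P[/andP[vw vc] wc uc]; split=> //.
by vlia.
Qed.

Lemma misses_no_cycle c v w : misses c v w -> no_cycle D (size c).+1.
Proof. by move/missesP=> [_ _ _ _ sz] c' u1 c1 s1; apply: (no_pre u1 c1); vlia. Qed.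

Lemma misses_out c v w z : misses c v w -> outdeg D z = D z v + D z w + oc z c.
Proof. by case=> _ /outdegE->; rewrite !oc_cons; vlia. Qed.

Lemma misses_in c v w z : misses c v w -> indeg D z = D v z + D w z + ic z c.
Proof. by case=> _ /indegE->; rewrite !ic_cons; vlia. Qed.

Lemma misses_deg c v w z : misses c v w -> deg D z = ac z v + ac z w + dg z c.
Proof. by case=> _ /degE->; rewrite !dg_cons; vlia. Qed.

Lemma misses_dg c v w : misses c v w -> dg v c + 2 <= n.
Proof.
move=> m; have [uc vc wc vw sz] := missesP m.
by have := insert_bound uc m.1 vc (misses_no_cycle m); vlia.
Qed.

Lemma misses_skip c v w : misses c v w -> D w v -> ic w c + oc v c + 2 <= n.
Proof.
move=> m wv; have [uc vc wc vw sz] := missesP m.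
have := @skip_bound _ D c w [:: v] uc m.1; rewrite /= addn1 wv inE eq_sym vw.
move=> /(_ _ isT _ isT (misses_no_cycle m)) H.
suff : ic w c + oc v c <= size c by vlia.
by apply: H; [vlia | move=> y; rewrite !inE => /orP[]/eqP->].
Qed.

(** The detour through [v] leaves at the last vertex of [r :: P], returns at [r] and skips [us].
    Only the vertex set of [c] is retained; its cyclic order may change. *)
Definition gap (c : seq V) v r (P us : seq V) :=
  [/\ perm_eq (r :: P ++ us) c, path D r P, path D (last r P) (rcons us r),
      D (last r P) v & D v r].

(** A skipped vertex adjacent to [v] serves as a new point of return or departure and shortens the
    gap. The gap never becomes empty, since [v] would then fit in and only [w] be missed. The
    inclusion in [us] later locates the new gap. *)
Lemma subgap c v w r P us : misses c v w -> gap c v r P us ->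
  exists r' P' us', [/\ gap c v r' P' us', us' != [::], {subset us' <= us} &
    {in us', forall u, na v u}].
Proof.
move=> m; have [uc vc wc vw sz] := missesP m.
have [k] := ubnP (size us); elim: k r P us => // k IHk r P us sk g.
have [perm_c rP rus xv vr] := g.
have [/hasP[u uus]|] := boolP (has (fun u => ~~ na v u) us).
  have uv : v != u.
    by apply: contraNneq vc => ->; rewrite -(perm_mem perm_c) inE mem_cat uus !orbT.
  case/splitPr: uus sk g perm_c rus => us1 us2 sk g perm_c.
  rewrite -cats1 -catA cat_path /= cats1 => /and3P[p1 d1 p2].
  rewrite naE uv /= negb_and !negbK => /orP[vu|uv'].
    case: (IHk u (us2 ++ r :: P) us1) => //.
    - by move: sk; rewrite size_cat /=; vlia.
    - split; rewrite ?last_cat //=; first by perm_lia.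
        by rewrite -cat_rcons cat_path p2 last_rcons.
      by rewrite rcons_path p1.
    move=> r' [P' [us' [g' n' s' a']]]; exists r', P', us'; split=> //.
    by move=> y /s'; rewrite mem_cat => ->.
  case: (IHk r (P ++ rcons us1 u) us2) => //.
  - by move: sk; rewrite size_cat /=; vlia.
  - split; rewrite ?last_cat ?last_rcons //=; first by perm_lia.
    by rewrite cat_path rP rcons_path p1.
  move=> r' [P' [us' [g' n' s' a']]]; exists r', P', us'; split=> //.
  by move=> y /s'; rewrite mem_cat inE => ->; rewrite !orbT.
move=> /hasPn H; exists r, P, us; split=> //; last by move=> u /H; rewrite negbK.
apply/eqP => us0; rewrite us0 in perm_c.
apply: (@no_almost_spanning r P [:: v] w) => //; first by rewrite /= xv vr.
by have [_ sp] := m; span_lia.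
Qed.

Lemma gap_exists c v w : misses c v w -> 0 < ic v c -> 0 < oc v c ->
  exists r P us, [/\ gap c v r P us, us != [::] & {in us, forall u, na v u}].
Proof.
move=> m /ic_gt0P[x xc xv] /oc_gt0P[r rc vr].
have [uc vc wc vw sz] := missesP m.
case: (rot_to rc) => i s E; have pE : perm_eq (r :: s) c by rewrite -E perm_rot.
have := m.1; rewrite -(rot_cycle i) E /= => cs.
have [P [us [Es lx]]] : exists P us, s = P ++ us /\ last r P = x.
  move: xc; rewrite -(perm_mem pE) inE => /orP[/eqP->|]; first by exists [::], s.
  by case/splitPr=> s1 s2; exists (rcons s1 x), s2; rewrite cat_rcons last_rcons.
have g : gap c v r P us.
  rewrite Es in pE cs; move: cs; rewrite rcons_cat cat_path => /andP[p1 p2].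
  by split; rewrite ?lx // -lx.
by have [r' [P' [us' [g' n' _ a']]]] := subgap m g; exists r', P', us'.
Qed.

(** If [v] fitted inside [r :: P], then [us] would close up a cycle missing only [w]. The 2 stands
    for the arcs of the detour at the two ends of the path. *)
Lemma gap_dg c v w r P us : misses c v w -> gap c v r P us ->
  {in us, forall u, na v u} -> dg v c <= size P + 2.
Proof.
move=> m [perm_c rP rus xv vr] nus.
rewrite -(dg_perm D v perm_c) -cat_cons dg_cat [dg v us]dg0 ?addn0; last first.
  by move=> y /nus /na_ac.
rewrite leqNgt; apply/negP => H.
have [|P' [rP' lP' pP']] := @insert_path _ D v r P rP.
  by rewrite xv vr; vlia.
apply: (@no_almost_spanning r P' us w) => //; rewrite ?lP' //.
by have [_ sp] := m; span_lia.
Qed.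

(** Were all of [us] inserted into [r :: P], closing through [v] would miss only [w]; so some [g] is
    stuck. Its bound and that of [gap_dg] add up to twice [size c], whatever the size of the gap. *)
Lemma gap_pair c v w r P us : misses c v w -> gap c v r P us -> us != [::] ->
    {in us, forall u, na v u} ->
  exists g, [/\ g \in us, na v g & dg g c + dg v c + 4 <= 2 * n].
Proof.
move=> m g n0 nus; have [perm_c rP rus xv vr] := g.
have [uc vc wc vw sz] := missesP m.
have [P' [X' [rP' lP' pX [/andP[_ sX'] sX] stuck]]] := greedy_insertion rP (leq0n (size us)).
have n0' : X' != [::].
  apply/eqP => X0; rewrite X0 cats0 in pX.
  apply: (@no_almost_spanning r P' [:: v] w) => //; first by rewrite lP' /= xv vr.
  by have [_ sp] := m; span_lia.
case: stuck => [X0|stuck]; first by case: X' X0 n0' {pX sX sX'}.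
case: X' n0' pX sX sX' stuck => // h X' _ pX sX sX' stuck.
have hus : h \in us by apply: sX; rewrite mem_head.
exists h; split=> //; first exact: nus.
have pc : perm_eq (r :: P' ++ (h :: X') ++ [::]) c by perm_lia.
have le : dg h (r :: P') <= size P' + 2.
  by have := stuck h (mem_head _ _); do 2![case: (D _ _)] => /=; vlia.
have := stuck_dg D_loopless uc pc (mem_head _ _) le.
have := gap_dg m g nus; have := psize pX; have := psize perm_c.
move: sX'.
by rewrite /= !size_cat /=; vlia.
Qed.

(* The degree condition at (v, g, w) and [skip_bound] for the path w, v. *)
Lemma misses_double c v w : misses c v w -> 0 < ic v c -> 0 < oc v c ->
  D v w && D w v.
Proof.
move=> m ic0 oc0; have [uc vc wc vw sz] := missesP m.
have [r [P [us [g n0 nus]]]] := gap_exists m ic0 oc0.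
have [h [hus nvh le]] := gap_pair m g n0 nus.
have hc : h \in c.
  by have [pc _ _ _ _] := g; rewrite -(perm_mem pc) inE mem_cat hus !orbT.
have hw : h != w by apply: contraNneq wc => <-.
have hv : h != v by apply: contraNneq vc => <-.
have degv := misses_deg v m; rewrite acxx // in degv.
have degh := misses_deg h m; rewrite acC (na_ac nvh) in degh.
have := ac_le D h w; have := misses_dg m => dv dw.
have [vw'|vw'] := boolP (D v w); have [wv|wv] := boolP (D w v) => //.
- have := cond_in D_cond nvh (z := w); rewrite eq_sym vw eq_sym hw wv.
  move=> /(_ isT isT isT).
  rewrite (misses_in v m) (misses_out w m) !D_loopless (negbTE wv) /=.
  have := misses_skip (missesC m) vw'.
  by move: degv degh; rewrite /ac vw' (negbTE wv) /=; vlia.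
- have := cond_out D_cond nvh (z := w); rewrite eq_sym vw eq_sym hw vw'.
  move=> /(_ isT isT isT).
  rewrite (misses_out v m) (misses_in w m) !D_loopless (negbTE vw') /=.
  have := misses_skip m wv.
  by move: degv degh; rewrite /ac wv (negbTE vw') /=; vlia.
(* Without arcs between [v] and [w] both have degree at most [n - 2], and [v] would have two bad
   partners, [w] and [h]. *)
- have nvw : na v w by rewrite naE vw vw' wv.
  have dwc := misses_dg (missesC m).
  have degw := misses_deg w m; rewrite acxx // acC in degw.
  have b1 : bad D v w.
    by rewrite /bad nvw /=; move: degv degw; rewrite (na_ac nvw); vlia.
  have b2 : bad D v h.
    by rewrite /bad nvh /=; move: degv degh; rewrite (na_ac nvw); vlia.
  by case/eqP: hw; apply: bad_unique b1 b2.
Qed.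

(** If just one arc joins [u] and [w], the bad-pair inequality for the absent arc contradicts
    [misses_skip] along the present one. If there is none, both degrees are too small for [bad_na].
    The cycle [c'] is what makes these bounds available for [u]. *)
Lemma bad_swap_double c c' u v w :
  misses c v w -> misses c' u w -> bad D u v -> D u w && D w u.
Proof.
move=> m m' buv; have [uc vc wc vw sz] := missesP m.
have [uc' uc0 wc' uw sz'] := missesP m'.
have wu : w != u by rewrite eq_sym.
have wv : w != v by rewrite eq_sym.
have [uw'|uw'] := boolP (D u w); have [wu'|wu'] := boolP (D w u) => //.
- have := bad_in D_cond buv wu wv wu'.
  rewrite (misses_in u m') (misses_out w m') !D_loopless (negbTE wu') /=.
  by have := misses_skip (missesC m') uw'; vlia.
- have := bad_out D_cond buv wu wv uw'.
  rewrite (misses_out u m') (misses_in w m') !D_loopless (negbTE uw') /=.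
  by have := misses_skip m' wu'; vlia.
- have nuw : na u w by rewrite naE uw uw' wu'.
  have := bad_na D_cond buv nuw wv.
  rewrite (misses_deg u m') (misses_deg w m) !acxx // (na_ac nuw).
  by have := ac_le D w v; have := misses_dg (missesC m); have := misses_dg m'; vlia.
Qed.

(** * Gaps with at least two skipped vertices *)

Section LargeGap.

Variables (c : seq V) (v w r : V) (P us : seq V).
Hypothesis m : misses c v w.
Hypothesis vw : D v w.
Hypothesis wv : D w v.
Hypothesis g0 : gap c v r P us.
Hypothesis nus : {in us, forall u, na v u}.
Hypothesis us_ge2 : 2 <= size us.

Local Notation x := (last r P).

Let pc : perm_eq (r :: P ++ us) c. Proof. by case: g0. Qed.
Let rP : path D r P. Proof. by case: g0. Qed.
Let rus : path D x (rcons us r). Proof. by case: g0. Qed.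
Let xv : D x v. Proof. by case: g0. Qed.
Let vr : D v r. Proof. by case: g0. Qed.
Let sp : spanning [:: v, w & c]. Proof. by case: m. Qed.
Let uc : uniq c. Proof. by case: (missesP m). Qed.

Let sizes : size P + size us + 3 = n.
Proof.
case: (missesP m) => _ _ _ _; have := psize pc.
by rewrite /= size_cat; vlia.
Qed.

Let uus : uniq us.
Proof. by have := perm_uniq pc; rewrite uc /= cat_uniq => /and4P[]. Qed.

Let degv : deg D v <= size P + 4.
Proof.
rewrite (misses_deg v m) acxx // /ac vw wv.
by have := gap_dg m g0 nus; vlia.
Qed.

Let degu u : u \in us -> deg D u = ac u w + dg u c.
Proof. by move=> /nus nvu; rewrite (misses_deg u m) acC (na_ac nvu). Qed.

(** Leaving the gap at [y] through [w], [v] to [r] would miss only [z]; dually below, entering it at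
    [b] through [v], [w] would miss only [a]. *)
Let penultimate_not_to_w us' y z : us = us' ++ [:: y; z] -> ~~ D y w.
Proof.
move=> E; apply/negP => yw.
apply: (@no_almost_spanning r P (us' ++ [:: y; w; v]) z) => //.
  by move: rus; rewrite E; path_tac.
by move: pc; rewrite E => ?; span_lia.
Qed.

Let second_not_from_w a b us' : us = [:: a, b & us'] -> ~~ D w b.
Proof.
move=> E; apply/negP => wb.
apply: (@no_almost_spanning r P [:: v, w, b & us'] a) => //.
  by move: rus; rewrite E; path_tac.
by move: pc; rewrite E => ?; span_lia.
Qed.

Let us_split2 b y a us' us'' z u :
  us = [:: a, b & us'] -> us = us'' ++ [:: y; z] -> b = u -> y = u ->
  exists z', us = [:: a; u; z'].
Proof.
move=> E1 E2 bu yu; have iy : index u us = size us''.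
  have := uus; rewrite E2 yu cat_uniq => /and3P[_ /= H _].
  rewrite index_cat; case: ifP => [H'|_]; last by rewrite /= eqxx addn0.
  by case/norP: H; rewrite H'.
have ib : index u us = 1.
  have := uus; rewrite E1 bu /= inE negb_or => /andP[/andP[au _] _].
  by rewrite (negbTE au) eqxx.
have : size us = 3 by rewrite E2 size_cat -iy ib.
rewrite E1 bu; case: us' {E1} => [|z' []] // _; first by exists z'.
Qed.

Let insertion : exists P' X' : seq V,
  [/\ path D r P', last r P' = x, perm_eq (P' ++ X') (P ++ us),
      [/\ X' != [::], size X' <= size us & {subset X' <= us}] &
      forall g, g \in X' -> dg g (r :: P') <= size P' + D g r + D x g].
Proof.
have [P' [X' [rP' lP' pX [/andP[_ sX'] sX] stuck]]] :=
  greedy_insertion rP (leq0n (size us)).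
have n0 : X' != [::].
  apply/eqP => X0; rewrite X0 cats0 in pX.
  apply: (@no_almost_spanning r P' [:: v] w) => //; first by rewrite lP' /= xv vr.
  span_lia.
exists P', X'; split=> //; case: stuck => // X0; by case: X' X0 n0 {pX sX sX'}.
Qed.

Let stuckE P' X' Y g :
    perm_eq (r :: P' ++ X' ++ Y) c -> g \in X' -> g \in us ->
    dg g (r :: P') <= size P' + D g r + D x g ->
  deg D g <= ac g w + size P' + 2 * (size X' + size Y).
Proof.
move=> p gX gus le; have le' : dg g (r :: P') <= size P' + 2.
  by move: le; do 2![case: (D _ _)] => /=; vlia.
by have := stuck_dg D_loopless uc p gX le'; rewrite (degu gus); vlia.
Qed.

(** Skipped vertices other than [u] have large degree by [bad_na]. One of them can be stuck only if
    everything inserted with it is stuck too and [w] is joined to it in both directions, which fails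
    at the second or the last but one place. *)
Lemma large_gap_bad u : u \in us -> bad D v u -> False.
Proof.
move=> uu bvu.
have dgg g : g \in us -> g != u -> 2 * n <= size P + 4 + deg D g.
  by move=> gus gu; have := bad_na D_cond bvu (nus gus) gu; move: degv; vlia.
have [P' [X' [rP' lP' pX [n0 sX' sX] stuck]]] := insertion.
have pc' : perm_eq (r :: P' ++ X') c by perm_lia.
have sz' := psize pX; rewrite !size_cat in sz'.
have uX' : uniq X'.
  by have := perm_uniq pc'; rewrite uc /= cat_uniq => /and4P[].
(* If some [g] other than [u] is stuck, then [X'] is all of [us] and only [u] can lack an arc with
   [w], so [u] is both second and last but one. *)
have [/hasP[g gX gu]|] := boolP (has (fun g => g != u) X').
  have pc0 : perm_eq (r :: P' ++ X' ++ [::]) c by rewrite cats0.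
  have key h : h \in X' -> h != u -> size us + 2 <= ac h w + size X'.
    move=> hX hu; have := stuckE pc0 hX (sX _ hX) (stuck _ hX).
    by have := dgg h (sX _ hX) hu; rewrite /=; move: sizes sz'; vlia.
  have sX'' : size us <= size X' by have := key g gX gu; have := ac_le D g w; vlia.
  have pX' : perm_eq X' us by apply: subset_size_perm.
  have acw h : h \in us -> h != u -> D h w && D w h.
    rewrite -(perm_mem pX') => hX hu; have := key h hX hu; move: sX' sX''.
    by rewrite /ac; case: (D h w); case: (D w h) => //=; vlia.
  have [us'' [y [z E2]]] := split_last2 us_ge2.
  have [a [b [us' E1]]] : exists a b us', us = [:: a, b & us'].
    by case: us us_ge2 => // a [|b us'] // _; exists a, b, us'.
  have bu : b = u.
    apply/eqP; apply: contraT => bu; have := second_not_from_w E1.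
    by have /acw/(_ bu)/andP[_ ->] : b \in us by rewrite E1 !inE eqxx orbT.
  have yu : y = u.
    apply/eqP; apply: contraT => yu; have := penultimate_not_to_w E2.
    by have /acw/(_ yu)/andP[-> _] : y \in us by rewrite E2 mem_cat !inE eqxx !orbT.
  have [z' E] := us_split2 E1 E2 bu yu.
  have := uus; rewrite E /= !inE negb_or => /and3P[/andP[au az] uz _].
  have aus : a \in us by rewrite E mem_head.
  have zus : z' \in us by rewrite E !inE eqxx !orbT.
  have /andP[_ wz] : D z' w && D w z' by apply: acw; rewrite // eq_sym.
  (* The inequality is tight: [ac a w], [ac a u], [ac a z'], [D a r] and [D x a] must sum to 8,
     their maximum. *)
  have : ac a z' = 2 /\ D a r.
    have := dgg a aus au; rewrite (degu aus) -(dg_perm D a pc') -cat_cons dg_cat.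
    have -> : dg a X' = ac a u + ac a z'.
      by rewrite (dg_perm D a pX') E !dg_cons dg_nil acxx //; vlia.
    have aX : a \in X' by rewrite (perm_mem pX').
    have := stuck a aX; move: sizes sz'; rewrite (psize pX') E /=.
    have := ac_le D a z'; have := ac_le D a u; have := ac_le D a w.
    case: (D a r); case: (D x a) => /=; split=> //; vlia.
  case=> aa ar.
  apply: (@no_almost_spanning r P' [:: v; w; z'; a] u) => //.
    rewrite lP' /= xv vw wz ar /=.
    by move: aa; rewrite /ac; case: (D z' a); case: (D a z').
  by move: pX'; rewrite E => ?; span_lia.
(* Only [u] is stuck. The other skipped vertices now lie on the path, so [v] can take the place of
   [u] on a cycle. *)
move=> /hasPn allu.
have EX : X' = [:: u].
  case: X' n0 uX' allu {pX sX' sX stuck pc' sz'} => // g [|h X'] _ uX' allu.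
    by have := allu g (mem_head _ _); rewrite negbK => /eqP->.
  have /allu := mem_head g (h :: X'); have := allu h; rewrite !inE eqxx orbT.
  move=> /(_ isT); rewrite !negbK => /eqP hu /eqP gu.
  by move: uX'; rewrite hu gu /= inE eqxx.
rewrite {}EX in pX pc' *.
have m' : misses (r :: P' ++ [:: v]) u w.
  split; first by rewrite cycle_catE rP' lP' /= xv vr.
  span_lia.
have /andP[uw wu] : D u w && D w u.
  by apply: bad_swap_double m m' _; rewrite badC.
have [us1 [us2 E]] : exists us1 us2, us = us1 ++ u :: us2.
  by case/splitPr: uu => us1 us2; exists us1, us2.
have := uus; rewrite E cat_uniq /= => /and4P[u1 /norP[uu1 _] uu2 u2].
have szs : size us1 + size us2 + 1 = size us by rewrite E size_cat /=; vlia.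
(* Only the part of the gap on one side of [u] is inserted. A single leftover is avoided by a cycle
   that uses [u], [v] and [w] and misses nothing else, so more must be stuck. *)
have [s2|s2] := leqP 2 (size us2).
- have k1 : 1 <= size us2 by apply: ltnW.
  have [P2 [X2 [rP2 lP2 pX2 [/andP[l2 sX2'] sX2] stuck2]]] := greedy_insertion rP k1.
  have sz2 := psize pX2; rewrite !size_cat in sz2.
  case: stuck2 => [X1|stuck2].
    case: X2 X1 pX2 {l2 sX2' sX2 sz2} => // z [] // _ pX2.
    apply: (@no_almost_spanning r P2 (us1 ++ [:: u; w; v]) z) => //.
      by move: rus; rewrite lP2 E; path_tac.
    by move: pc; rewrite E => ?; span_lia.
  have pc2 : perm_eq (r :: P2 ++ X2 ++ (u :: us1)) c.
    by move: pc; rewrite E => ?; perm_lia.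
  have sub2 y : y \in us2 -> y \in us /\ y != u.
    move=> yu2; rewrite E mem_cat inE yu2 !orbT; split=> //.
    by apply: contraNneq uu2 => <-.
  have key h : h \in X2 -> size us2 + 2 <= ac h w + size X2.
    move=> hX; have [hus hu] := sub2 h (sX2 _ hX).
    have := stuckE pc2 hX hus (stuck2 _ hX).
    by have := dgg h hus hu; rewrite /=; move: sizes sz2 szs; vlia.
  have sX2'' : size us2 <= size X2.
    case: X2 l2 key {sX2' sX2 stuck2 pX2 pc2 sz2} => // h X2 _ /(_ h (mem_head _ _)).
    by have := ac_le D h w; vlia.
  have uX2 : uniq X2.
    by have := perm_uniq pc2; rewrite uc /= !cat_uniq => /andP[_ /and3P[_ _ /andP[]]].
  have pp : perm_eq X2 us2 by apply: subset_size_perm.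
  have [us'' [y [z E2]]] := split_last2 s2.
  have yX : y \in X2 by rewrite (perm_mem pp) E2 mem_cat !inE eqxx !orbT.
  have := @penultimate_not_to_w (us1 ++ u :: us'') y z; rewrite E E2 -catA => /(_ erefl) nyw.
  have := key y yX; rewrite /ac (negbTE nyw) add0n.
  by have := leq_b1 (D w y); vlia.
(* Being joined to [w] both ways, [u] is neither second nor last but one in the gap. *)
- have s1 : 2 <= size us1.
    case: us2 E szs s2 {u2 uu2} => [|z [|z' us2]] E szs //= _.
      case: us1 E szs {u1 uu1} => [|a [|b us1]] //= E szs; first by move: us_ge2; vlia.
      by have := second_not_from_w E; rewrite wu.
    by have := penultimate_not_to_w E; rewrite uw.
  have k1 : 1 <= size us1 by apply: ltnW.
  have [P2 [X2 [rP2 lP2 pX2 [/andP[l2 sX2'] sX2] stuck2]]] := greedy_insertion rP k1.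
  have sz2 := psize pX2; rewrite !size_cat in sz2.
  case: stuck2 => [X1|stuck2].
    case: X2 X1 pX2 {l2 sX2' sX2 sz2} => // z [] // _ pX2.
    apply: (@no_almost_spanning r P2 [:: v, w, u & us2] z) => //.
      by move: rus; rewrite lP2 E; path_tac.
    by move: pc; rewrite E => ?; span_lia.
  have pc2 : perm_eq (r :: P2 ++ X2 ++ (u :: us2)) c.
    by move: pc; rewrite E => ?; perm_lia.
  have sub1 y : y \in us1 -> y \in us /\ y != u.
    move=> yu1; rewrite E mem_cat yu1; split=> //.
    by apply: contraNneq uu1 => <-.
  have key h : h \in X2 -> size us1 + 2 <= ac h w + size X2.
    move=> hX; have [hus hu] := sub1 h (sX2 _ hX).
    have := stuckE pc2 hX hus (stuck2 _ hX).
    by have := dgg h hus hu; rewrite /=; move: sizes sz2 szs; vlia.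
  have sX2'' : size us1 <= size X2.
    case: X2 l2 key {sX2' sX2 stuck2 pX2 pc2 sz2} => // h X2 _ /(_ h (mem_head _ _)).
    by have := ac_le D h w; vlia.
  have uX2 : uniq X2.
    by have := perm_uniq pc2; rewrite uc /= !cat_uniq => /andP[_ /and3P[_ _ /andP[]]].
  have pp : perm_eq X2 us1 by apply: subset_size_perm.
  case: us1 E s1 pp {u1 uu1 szs sub1 k1 sX2' pX2 sX2 sz2} key sX2'' => //.
  move=> a [|b us1] // E _ pp key sX2''.
  have bX : b \in X2 by rewrite (perm_mem pp) !inE eqxx !orbT.
  have nwb := second_not_from_w E.
  have := key b bX; rewrite /ac (negbTE nwb) addn0 -(psize pp).
  by have := leq_b1 (D b w); vlia.
Qed.

(** With no bad partner of [v] in the gap the degree bounds are weaker by just one. This slack is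
    used up by the arcs with [w] that are absent at the second and at the last but one vertex. *)
Lemma large_gap_false : False.
Proof.
have [/hasP[u uu bu]|/hasPn nob] := boolP (has (bad D v) us).
  exact: large_gap_bad uu bu.
have dgg g : g \in us -> 2 * n <= size P + 4 + deg D g + 1.
  move=> gus; have := nob _ gus; rewrite /bad nus //= -ltnNge.
  by move: degv; vlia.
have [P' [X' [rP' lP' pX [n0 sX' sX] stuck]]] := insertion.
have pc' : perm_eq (r :: P' ++ X') c by perm_lia.
have sz' := psize pX; rewrite !size_cat in sz'.
have uX' : uniq X'.
  by have := perm_uniq pc'; rewrite uc /= cat_uniq => /and4P[].
have pc0 : perm_eq (r :: P' ++ X' ++ [::]) c by rewrite cats0.
have key h : h \in X' -> size us + 1 <= ac h w + size X'.
  move=> hX; have := stuckE pc0 hX (sX _ hX) (stuck _ hX).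
  by have := dgg h (sX _ hX); rewrite /=; move: sizes sz'; vlia.
have [us'' [y [z E2]]] := split_last2 us_ge2.
have [a [b [us' E1]]] : exists a b us', us = [:: a, b & us'].
  by case: us us_ge2 => // a [|b us'] // _; exists a, b, us'.
have bus : b \in us by rewrite E1 !inE eqxx orbT.
have yus : y \in us by rewrite E2 mem_cat !inE eqxx !orbT.
have nwb := second_not_from_w E1; have nyw := penultimate_not_to_w E2.
(* If one vertex went in, it is both second and last but one, as all stuck vertices have both arcs
   with [w]. *)
have [ltX|leX] := ltnP (size X') (size us).
  have acw h : h \in X' -> D h w && D w h.
    move=> hX; have := key h hX; move: ltX.
    by rewrite /ac; case: (D h w); case: (D w h) => //=; vlia.
  have szX : size us = (size X').+1.
    case: X' n0 ltX key {pX sX' sX stuck pc' sz' uX' pc0 acw} => // h X' _ ltX.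
    by move=> /(_ h (mem_head _ _)); have := ac_le D h w; move: ltX; rewrite /=; vlia.
  have bX : b \notin X' by apply: contra nwb => /acw/andP[].
  have pus : perm_eq (b :: X') us.
    apply: subset_size_perm => //=; first by rewrite bX uX'.
      by move=> h; rewrite inE => /orP[/eqP->//|/sX].
    by rewrite szX.
  have yb : y = b.
    move: yus; rewrite -(perm_mem pus) inE => /orP[/eqP//|/acw/andP[yw _]].
    by rewrite yw in nyw.
  have [z' E] := us_split2 E1 E2 erefl yb.
  have aX : a \in X'.
    have : a \in b :: X' by rewrite (perm_mem pus) E mem_head.
    rewrite inE => /orP[/eqP ab|//].
    by have := uus; rewrite E ab /= inE eqxx.
  have /andP[aw _] := acw a aX.
  apply: (@no_almost_spanning r P' [:: a; w; v] z') => //.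
    by rewrite lP' /= aw wv vr; move: rus; rewrite E /= => /andP[->].
  by move: pus pX; rewrite E => ? ?; span_lia.
have pX' : perm_eq X' us by apply: subset_size_perm.
have pcP : perm_eq (r :: P' ++ us) c by perm_lia.
have szP : size P' = size P by have := psize pX'; move: sz'; vlia.
have tot g : g \in us ->
    2 * size us + 1 <= ac g w + D g r + D x g + dg g us.
  move=> gus; have := dgg g gus; rewrite (degu gus) -(dg_perm D g pcP) -cat_cons.
  rewrite dg_cat; have gX : g \in X' by rewrite (perm_mem pX').
  by have := stuck g gX; move: sizes szP; vlia.
have dgus g : g \in us -> dg g us + 2 <= 2 * size us.
  move=> gus; have := dg_mem_le D_loopless gus.
  by have : 0 < size us by [case: us gus]; vlia.
have [/andP[bw xb] fullb] : D b w && D x b /\ 2 * size us <= dg b us + 2.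
  have := tot b bus; have := dgus b bus; rewrite /ac (negbTE nwb).
  by case: (D b w); case: (D x b); case: (D b r) => /=; split=> //; vlia.
case: us' E1 => [|z' us'] E1.
  apply: (@no_almost_spanning r P' [:: b; w; v] a) => //.
    by rewrite lP' /= xb bw wv vr.
  by move: pcP; rewrite E1 => ?; span_lia.
have [yr fully] : D y r /\ D w y.
  have := tot y yus; have := dgus y yus; rewrite /ac (negbTE nyw).
  by case: (D w y); case: (D x y); case: (D y r) => /=; split=> //; vlia.
have by' : b != y by apply: contraNneq nwb => ->.
have [mid E3] : exists mid, us = [:: a, b & mid ++ [:: y; z]].
  move: E2; rewrite E1; case: us'' => [|a' [|b' mid]].
  - by [].
  - by case=> _ by0; rewrite by0 eqxx in by'.
  by case=> _ _ ->; exists mid.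
have zus : z \in us by rewrite E2 mem_cat !inE eqxx !orbT.
(* The vertex [a] is given up in both cases. If [z] has no arc to [w], the count at [z] forces
   [w -> z -> b], and the section from [b] to [y] closes at [r]. *)
have [zw|zw] := boolP (D z w).
  apply: (@no_almost_spanning r P' (b :: mid ++ [:: y; z; w; v]) a) => //.
    by move: rus; rewrite E3 lP'; path_tac.
  by move: pcP; rewrite E3 => ?; span_lia.
have [wz zb] : D w z /\ D z b.
  have E4 : dg z us = ac z a + ac z b + dg z mid + ac z y.
    by rewrite E3 !dg_cons dg_cat !dg_cons dg_nil acxx //; vlia.
  have sz4 : size us = size mid + 4 by rewrite E3 /= size_cat /=; vlia.
  have : 3 <= D w z + ac z b.
    have := tot z zus; rewrite E4 {1}/ac (negbTE zw).
    have := dg_le D z mid; have := ac_le D z a; have := ac_le D z y.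
    by have := leq_b1 (D z r); have := leq_b1 (D x z); vlia.
  by rewrite /ac; case: (D w z); case: (D z b); case: (D b z).
apply: (@no_almost_spanning r P' [:: v, w, z, b & mid ++ [:: y]] a) => //.
  by move: rus; rewrite E3 lP'; path_tac.
by move: pcP; rewrite E3 => ?; span_lia.
Qed.

End LargeGap.

(** * Gaps with one skipped vertex *)

Lemma gap_single c v w r P us : misses c v w -> D v w -> D w v ->
    gap c v r P us -> us != [::] -> {in us, forall u, na v u} ->
  exists u, us = [:: u].
Proof.
move=> m vw wv g n0 nus; case: us n0 g nus => // u [|u' us] _ g nus.
  by exists u.
by case: (large_gap_false m vw wv g nus).
Qed.

Lemma gap_swap c v w r P u : misses c v w -> gap c v r P [:: u] ->
  misses (r :: P ++ [:: v]) u w /\ gap (r :: P ++ [:: v]) u r P [:: v].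
Proof.
move=> [_ sp] [pc rP /= /and3P[xu ur _] xv vr]; split; split=> //=.
- by rewrite rcons_cat cat_path rP /= xv vr.
- span_lia.
- by rewrite xv vr.
Qed.

Lemma gap_deg_le c v w r P u : misses c v w -> gap c v r P [:: u] ->
  deg D u <= n /\ deg D v <= n.
Proof.
move=> m g; have [m' g'] := gap_swap m g.
rewrite (misses_deg u m') (misses_deg v m) !acxx //.
have := misses_dg m; have := misses_dg m'.
by have := ac_le D u w; have := ac_le D v w; split; vlia.
Qed.

(* A second passage in -> out of v along the cycle would give a second
   one-vertex gap, i.e. a non-neighbour of v that is not its bad partner. *)
Lemma gap_monotone c v w r P u s1 s2 a b : misses c v w -> D v w -> D w v ->
    gap c v r P [:: u] -> bad D v u -> deg D v < n ->
    r :: P = s1 ++ s2 -> a \in s1 -> D a v -> b \in s2 -> D v b -> False.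
Proof.
move=> m vw wv g bvu dv Es; have [pc rP /= /and3P[xu ur _] xv vr] := g.
have pu : path D (last r P) (u :: r :: P) by rewrite /= xu ur rP.
move=> /splitPr a1 av b2 vb; case: a1 Es => t1 t2 Es.
case/splitPr: b2 Es => t3 t4 Es; rewrite Es in pu.
have lx : last r P = last b t4.
  by rewrite -[last r P]/(last r (r :: P)) Es !last_cat.
have pc1 : perm_eq (((t1 ++ a :: t2) ++ t3 ++ b :: t4) ++ [:: u]) c.
  by rewrite -Es.
have g1 : gap c v b (t4 ++ u :: t1 ++ [:: a]) (t2 ++ t3).
  rewrite lx in pu; split=> //; first by clear pc; perm_lia.
  - by move: pu; path_tac.
  - by rewrite last_cat /= last_cat /=; move: pu; path_tac.
  - by rewrite last_cat /= last_cat.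
have [r' [P' [us' [g' n' sub nus']]]] := subgap m g1.
have [h Eh] := gap_single m vw wv g' n' nus'.
rewrite {us'}Eh in g' sub nus' {n'}.
have hR : h \in r :: P.
  have := sub h (mem_head _ _); rewrite Es !(mem_cat, inE).
  by case/orP=> ->; rewrite !orbT.
have hu : h != u.
  have [uc _ _ _ _] := missesP m; have := perm_uniq pc; rewrite uc.
  rewrite -cat_cons cat_uniq => /and3P[_ /hasPn /(_ u (mem_head _ _)) H _].
  by apply: contraNneq H => <-.
(* As [h] is not the bad partner of [v], the two degrees sum to at least [2n]; but both are at most
   [n] and that of [v] is smaller. *)
have := bad_na D_cond bvu (nus' h (mem_head _ _)) hu.
by have [] := gap_deg_le m g'; vlia.
Qed.

(** The out-neighbours of [v] on the path end at [yv], its in-neighbours and those of [u] begin no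
    earlier than [yv] and [yu], and [yv] comes no later than [yu]. So the vertex [y] before [yv] has
    no arc to [u], and the bad-pair inequality at [y] produces consecutive [p], [q] from [yu] on
    with [p -> u] and [y -> q]. *)
Lemma crossing u v w r P Lv yv Mv Lu yu Mu :
    spanning [:: u, v, w, r & P] -> path D r P ->
    D (last r P) u -> D u r -> D (last r P) v -> D v r ->
    D u w -> D w u -> D v w -> D w v -> bad D u v -> deg D v < n ->
    r :: P = Lv ++ yv :: Mv -> D v yv -> {in Mv, forall z, ~~ D v z} ->
    {in Lv, forall z, ~~ D z v} ->
    r :: P = Lu ++ yu :: Mu -> {in Lu, forall z, ~~ D z u} ->
  size Lv <= size Lu -> False.
Proof.
move=> sp rP xu ur xv vr uw wu vw wv buv dv Ev vyv MvO LvI Eu LuI szL.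
have /andP[nuv _] := buv; have nvu := nuv; rewrite naC in nvu.
have uvD : ~~ D u v by move: nuv; rewrite naE => /and3P[].
have vuD : ~~ D v u by move: nuv; rewrite naE => /and3P[].
have sz := spanning_size sp; have un := spanning_uniq sp.
(* If [yv = r] there is no such [y]. Then [v] has a single out-neighbour on the path, too few for
   the inequality at the second path vertex. *)
case/lastP: Lv Ev LvI szL => [|L0 y] Ev LvI szL.
  case: Ev => Er EP; rewrite -{}EP in MvO.
  case: P MvO sp rP xu xv sz un {Eu} => [|r2 P] MvO sp rP xu xv sz un.
    rewrite /= in xv; move: dv; rewrite (degE D v sp) !dg_cons acxx // dg_nil.
    by rewrite acC (na_ac nuv) /ac vw wv vr xv -sz.
  have vr2 : ~~ D v r2 by apply: MvO; rewrite mem_head.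
  have ur2 : ~~ D u r2.
    apply/negP => ur2; apply: (@no_almost_spanning r2 P [:: v; w; u] r).
    - by move: rP => /= /andP[].
    - by rewrite /=; apply/and5P.
    - span_lia.
  have [r2u r2v] : r2 != u /\ r2 != v.
    move: un; rewrite /= !inE !negb_or => /and3P[/and5P[_ _ _ H1 _] /and4P[_ _ H2 _] _].
    by rewrite ![r2 == _]eq_sym.
  have := bad_out D_cond (x := v) (y := u) (z := r2).
  rewrite badC => /(_ buv r2v r2u vr2).
  rewrite (outdegE D v sp) (indegE D r2 sp) !oc_cons !ic_cons !D_loopless (negbTE vr2).
  rewrite (negbTE vuD) (negbTE ur2).
  have -> : oc v P = 0.
    apply/eqP; rewrite -leqn0 leqNgt -has_count; apply/hasPn => z zP.
    by apply: MvO; rewrite inE zP orbT.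
  have := ic_le D r2 P; have := leq_b1 (D w r2); have := leq_b1 (D r r2).
  have := leq_b1 (D v w); have := leq_b1 (D v r).
  by move: sz; rewrite /= add0n; vlia.
have [B0 [ELu EMv]] : exists B, Lu = rcons L0 y ++ B /\ yv :: Mv = B ++ yu :: Mu.
  by apply: cat_eq_split szL; rewrite -Ev -Eu.
have yLu : y \in Lu by rewrite ELu mem_cat mem_rcons mem_head.
have yu' : ~~ D y u by apply: LuI.
have yv' : ~~ D y v by apply: LvI; rewrite mem_rcons mem_head.
have yR : y \in r :: P by rewrite Eu mem_cat yLu.
have [yNu yNv] : y != u /\ y != v.
  move: un; rewrite /= => /and3P[]; rewrite !in_cons !negb_or.
  move=> /and3P[_ _ /andP[u1 u2]] /andP[_ /andP[v1 v2]] _.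
  by split; apply: contraTneq yR => ->; rewrite inE negb_or ?u1 ?u2 ?v1 ?v2.
have := bad_in D_cond buv yNu yNv yu'.
have sp' : spanning [:: u, v, w & Lu ++ yu :: Mu] by rewrite -Eu.
rewrite (indegE D u sp') (outdegE D y sp') !ic_cons !oc_cons !D_loopless.
rewrite ic_cat oc_cat (negbTE vuD) (negbTE yu') (negbTE yv') !add0n oc_cons.
have -> : ic u Lu = 0.
  by apply/eqP; rewrite -leqn0 leqNgt -has_count; apply/hasPn => z /LuI.
have ocL : oc y Lu <= (size Lu).-1 by apply: (oc_mem_le yLu); rewrite D_loopless.
have szLu : 0 < size Lu by case: Lu yLu {Eu LuI ELu szL sp' ocL}.
have sz' := spanning_size sp'; rewrite /= size_cat /= in sz'.
have [lt|le] := ltnP (size Mu)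
    (count (fun z => D z u) (belast yu Mu) + count (D y) Mu); last first.
  rewrite /ic (lastI yu Mu) -cats1 count_cat /= addn0 => H.
  move: le; rewrite -[count (D y) Mu]/(oc y Mu).
  have := leq_b1 (D w u); have := leq_b1 (D (last yu Mu) u).
  by have := leq_b1 (D y w); have := leq_b1 (D y yu); move: H; vlia.
move=> _; have [p1 [p [q [p2 [Ep pu yq]]]]] := consecutive_pair lt.
have pR : path D u (r :: P) by rewrite /= ur rP.
have pV : path D v (yv :: Mv).
  by rewrite /= vyv; move: pR; rewrite Ev; path_tac.
have lx : last r P = last q p2.
  by rewrite -[last r P]/(last r (r :: P)) Eu Ep last_cat last_cat.
(* The crossing cycle runs from [u] through [r] to [y], jumps to [q], goes on to the end of the
   path, then to [v], [yv], up to [p] and back to [u]. *)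
apply: (@no_almost_spanning u (L0 ++ y :: q :: p2) (v :: B0 ++ p1 ++ [:: p]) w).
- by move: pR; rewrite Eu Ep ELu; path_tac.
- rewrite last_cat /= -lx xv; move: pV; rewrite EMv Ep.
  by path_tac.
- by move: sp'; rewrite Ep ELu => ?; span_lia.
Qed.

Lemma single_gap_false c v w r P u : misses c v w -> D v w -> D w v ->
    gap c v r P [:: u] -> na v u -> deg D v < n -> deg D u < n -> False.
Proof.
move=> m vw wv g nvu dv du; have [m' g'] := gap_swap m g.
have bvu : bad D v u by rewrite /bad nvu; vlia.
have buv : bad D u v by rewrite badC.
have /andP[uw wu] := bad_swap_double m m' buv.
have [pc rP /= /and3P[xu ur _] xv vr] := g.
have [Lv [yv [Mv [Ev vyv MvO]]]] :
    exists s1 y s2, [/\ r :: P = s1 ++ y :: s2, D v y & {in s2, forall z, ~~ D v z}].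
  by apply: split_last_has; rewrite /= vr.
have [Lu [yu [Mu [Eu uyu MuO]]]] :
    exists s1 y s2, [/\ r :: P = s1 ++ y :: s2, D u y & {in s2, forall z, ~~ D u z}].
  by apply: split_last_has; rewrite /= ur.
have LvI : {in Lv, forall z, ~~ D z v}.
  move=> z zL; apply/negP => zv.
  exact: (gap_monotone m vw wv g bvu dv Ev zL zv (mem_head _ _) vyv).
have LuI : {in Lu, forall z, ~~ D z u}.
  move=> z zL; apply/negP => zv.
  exact: (gap_monotone m' uw wu g' buv du Eu zL zv (mem_head _ _) uyu).
have sp : spanning [:: u, v, w, r & P] by have [_ sp] := m; span_lia.
have sp' : spanning [:: v, u, w, r & P] by span_lia.
have [le|/ltnW le] := leqP (size Lv) (size Lu).
  exact: (crossing sp rP xu ur xv vr uw wu vw wv buv dv Ev vyv MvO LvI Eu LuI le).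
exact: (crossing sp' rP xv vr xu ur vw wv uw wu bvu du Eu uyu MuO LuI Ev LvI le).
Qed.

(** * The extremal digraph *)

Definition balanced_bipartition := exists A : {set V}, #|A| = #|~: A| /\
  forall x y, D x y = (x \in A) (+) (y \in A).

(* An arc z -> z' inside T would give the cycle v, z+, ..., z'--, w, z, z', ...,
   z-, where + and - denote successors and predecessors on c. *)
Lemma alternating_indep c v w (T : pred V) : misses c v w -> D v w ->
    {in c, forall z, T z -> [/\ D z w, D w z, D v (next c z) & D (prev c z) v]} ->
    {in c, forall z, T z -> ~~ T (next c z)} ->
    {in c, forall z, T z -> T (prev c (prev c z))} ->
  forall z z', z \in c -> z' \in c -> T z -> T z' -> ~~ D z z'.
Proof.
move=> m vw HT Talt Tpp z z' zc z'c Tz Tz'; apply/negP => zz'.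
have [uc vc wc vw' sz] := missesP m.
have [zw wz vnz pzv] := HT z zc Tz.
have zNz' : z != z' by apply: contraTneq zz' => <-; rewrite D_loopless.
case: (rot_to zc) => i s E; have pE : perm_eq (z :: s) c by rewrite -E perm_rot.
have us : uniq (z :: s) by rewrite (perm_uniq pE).
have cs : cycle D (z :: s) by rewrite -E rot_cycle; case: m.
have nE y : next c y = next (z :: s) y by rewrite -(next_rot i uc) E.
have pE' y : prev c y = prev (z :: s) y by rewrite -(prev_rot i uc) E.
have z's : z' \in s.
  by move: z'c; rewrite -(perm_mem pE) inE eq_sym (negbTE zNz').
case/splitPr: z's E pE us cs nE pE' => s1 s2 E pE us cs nE pE'.
case/lastP: s1 E pE us cs nE pE' => [|s0 b] E pE us cs nE pE'.
  by have := Talt z zc Tz; rewrite nE (@next_mid _ [::]) // Tz'.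
have ls2 : prev c z = last z' s2.
  by rewrite pE' prev_head // last_cat.
rewrite ls2 in pzv.
have pQ : path D (last z' s2) (v :: s0 ++ [:: w; z; z']).
  case/lastP: s0 E pE us cs nE pE' => [|s00 y] E pE us cs nE pE'.
    by rewrite /= pzv vw wz zz'.
  have yw : D y w.
    have bc : b = prev c z'.
      apply: (can_inj (prev_next uc)); rewrite next_prev // nE.
      by move: us; rewrite cat_rcons -cat_cons => /next_mid.
    have yb : y = prev c b.
      apply: (can_inj (prev_next uc)); rewrite next_prev // nE.
      by move: us; rewrite !cat_rcons -cat_cons => /next_mid.
    have yc : y \in c by rewrite yb mem_prev bc mem_prev.
    by have [] := HT y yc; rewrite // yb bc; apply: Tpp.
  have vh : path D v (rcons s00 y).
    move: vnz cs; rewrite nE; case: s00 {E pE us nE pE'} => [|h s00] /=; rewrite eqxx => -> //.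
    by path_tac.
  by rewrite /= pzv; move: vh; path_tac.
apply: (@no_almost_spanning z' s2 (v :: s0 ++ [:: w; z]) b).
- by move: cs; rewrite /=; path_tac.
- by move: pQ; path_tac.
- by have [_ sp] := m; span_lia.
Qed.

(** Degree [n] is the equality case of [insert_bound]: for every [x] on [c] exactly one of [D x v],
    [D v (next c x)] holds. This rigidity makes non-neighbours of [v] ([T]) alternate with vertices
    joined to it both ways ([B]). *)
Lemma full_degree_bipartition c v w : misses c v w -> D v w -> D w v ->
  0 < ic v c -> 0 < oc v c -> deg D v = n -> balanced_bipartition.
Proof.
move=> m vw wv ic0 oc0 dv; have [uc vc wc vNw sz] := missesP m.
have [cc sp] := m; have nc := misses_no_cycle m.
have dgc : dg v c = size c.
  by move: dv; rewrite (misses_deg v m) acxx // /ac vw wv; move: sz; vlia.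
have skip a b : D a b -> a != b -> a \notin c -> b \notin c ->
    {in c, forall x, ~~ (D x a && D b (next c (next c x)))}.
  move=> ab aNb ac0 bc0 x xc; apply/negP => /andP[xa bx].
  have [] := @cycle_skip _ D c x a [:: b] uc cc _ xc _ _ xa _ bx.
  - by move: n_ge4 sz; vlia.
  - by rewrite /= inE aNb.
  - by move=> y; rewrite !inE => /orP[]/eqP->.
  - by rewrite /= ab.
  by move=> c' [u1 c1]; rewrite /= addn1; apply: nc.
have skipvw := skip v w vw vNw vc wc.
have wNv : w != v by rewrite eq_sym.
have skipwv := skip w v wv wNv wc vc.
have excl x : x \in c -> ~~ (D x v && D v (next c x)).
  move=> xc; apply/negP => /andP[xv vx].
  have [c' [u1 c1 p1]] := cycle_insert uc cc xc vc xv vx.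
  by apply: (nc c' u1 c1); rewrite (psize p1).
have tight x : x \in c -> D x v || D v (next c x).
  have cI : count (predI (fun y => D y v) (fun y => D v (next c y))) c = 0.
    by apply/eqP; rewrite -leqn0 leqNgt -has_count; apply/hasPn => y /excl.
  have := count_predUI (fun y => D y v) (fun y => D v (next c y)) c.
  have -> : count (fun y => D y v) c + count (fun y => D v (next c y)) c = size c.
    by rewrite (count_next (D v) uc) -dgc addnC.
  rewrite cI addn0 => /eqP.
  by rewrite -all_count => /allP; apply.
pose T z := na v z; pose B z := D z v && D v z.
have vN z : z \in c -> v != z by move=> zc; apply: contraNneq vc => ->.
have TE z : z \in c -> T z = ~~ D v z && ~~ D z v.
  by move=> zc; rewrite /T naE vN.
have nextc z : z \in c -> next c z \in c by rewrite mem_next.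
have prevc z : z \in c -> prev c z \in c by rewrite mem_prev.
have Tin z : z \in c -> T z -> D (prev c z) v.
  move=> zc; rewrite TE // => /andP[nvz _].
  by have := tight _ (prevc _ zc); rewrite next_prev // (negbTE nvz) orbF.
have Tout z : z \in c -> T z -> D v (next c z).
  move=> zc; rewrite TE // => /andP[_ nzv].
  by have := tight _ zc; rewrite (negbTE nzv).
(* A non-neighbour [z] of [v] lies between an in- and an out-neighbour of [v], so [v] can replace it
   and [misses_double] applies to [z], [w]. *)
have Tw z : z \in c -> T z -> D z w /\ D w z.
  move=> zc Tz; case: (rot_to zc) => i s E.
  have pE : perm_eq (z :: s) c by rewrite -E perm_rot.
  have ss : 0 < size s by have := psize pE; rewrite /=; move: n_ge4 sz; vlia.
  have us : uniq (z :: s) by rewrite (perm_uniq pE).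
  have cs : cycle D (z :: s) by rewrite -E rot_cycle.
  have vn := Tout z zc Tz; have pv := Tin z zc Tz.
  rewrite -(next_rot i uc) E in vn; rewrite -(prev_rot i uc) E in pv.
  case: s ss E pE us cs vn pv => // h s _ E pE us cs.
  rewrite prev_head // [next _ _]/= eqxx => vh lv.
  have m' : misses (v :: h :: s) z w.
    split; first by move: cs; rewrite /= vh !rcons_path lv => /and3P[_ ->].
    span_lia.
  move: cs; rewrite /= rcons_path => /and3P[zh _ lz].
  apply/andP; apply: (misses_double m').
    by apply/ic_gt0P; exists (last h s); rewrite // inE mem_last orbT.
  by apply/oc_gt0P; exists h; rewrite // !inE eqxx orbT.
(* The path [w], [v] cannot replace the successor of [z], so [v] has no arc to the second successor
   and [tight] gives the arc into [v]. *)
have Tnext z : z \in c -> T z -> B (next c z).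
  move=> zc Tz; rewrite /B Tout // andbT; have [zw _] := Tw z zc Tz.
  have := tight _ (nextc _ zc); have := skipwv z zc; rewrite zw /=.
  by move=> /negbTE ->; rewrite orbF.
have Tprev z : z \in c -> T z -> B (prev c z).
  move=> zc Tz; rewrite /B Tin //=; have [_ wz] := Tw z zc Tz.
  have p2c := prevc _ (prevc _ zc).
  have := tight _ p2c; have := skipvw _ p2c; rewrite !next_prev // wz andbT.
  by move=> /negbTE ->.
(* Each [ac v z] is 1, plus 1 on [B], minus 1 on [T], and the total is [size c]. With equal counts
   the injections [next] and [prev] from [T] into [B] are onto. *)
have cTB : count T c = count B c.
  have H s : {subset s <= c} -> dg v s + count T s = size s + count B s.
    elim: s => // y s IHs sub; rewrite dg_cons /=.
    have yc := sub y (mem_head _ _).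
    have := IHs (fun z zs => sub z (mem_behead (s := y :: s) zs)).
    by rewrite TE // /B /ac; case: (D v y); case: (D y v) => /=; vlia.
  by have := H c (fun z zc => zc); rewrite dgc; vlia.
have imB (f : V -> V) : injective f -> {in c, forall z, f z \in c} ->
    {in c, forall z, T z -> B (f z)} ->
    {in c, forall b, B b -> exists z, [/\ z \in c, T z & b = f z]}.
  move=> fI fc fB b bc Bb.
  have p : perm_eq (map f (filter T c)) (filter B c).
    apply: subset_size_perm; rewrite ?map_inj_uniq ?filter_uniq //.
    - move=> y /mapP[z]; rewrite !mem_filter => /andP[Tz zc] ->.
      by rewrite fB // fc.
    - by rewrite size_map !size_filter cTB.
  have : b \in map f (filter T c) by rewrite (perm_mem p) mem_filter Bb.
  by case/mapP=> z; rewrite mem_filter => /andP[Tz zc] ->; exists z.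
have Bnext b : b \in c -> B b -> T (next c b).
  move=> bc Bb; have [z [zc Tz ->]] := imB _ (can_inj (next_prev uc)) prevc Tprev b bc Bb.
  by rewrite next_prev.
have Bprev b : b \in c -> B b -> T (prev c b).
  move=> bc Bb; have [z [zc Tz ->]] := imB _ (can_inj (prev_next uc)) nextc Tnext b bc Bb.
  by rewrite prev_next.
have [t0 t0c Tt0] : exists2 z, z \in c & T z.
  have [r [P [us [[pc _ _ _ _] n0 nus]]]] := gap_exists m ic0 oc0.
  case: us n0 pc nus => // z us _ pc nus; exists z; last by apply: nus; rewrite mem_head.
  by rewrite -(perm_mem pc) !(inE, mem_cat) eqxx !orbT.
have TB : {in c, forall x, T x || B x}.
  apply: (next_closed uc t0c); first by rewrite Tt0.
  by move=> x xc /orP[Tx|Bx]; [rewrite Tnext ?orbT | rewrite Bnext].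
have TnB z : z \in c -> T z -> ~~ B z.
  by move=> zc; rewrite TE // /B => /andP[_ /negbTE->].
have Tindep z z' : z \in c -> z' \in c -> T z -> T z' -> ~~ D z z'.
  apply: (alternating_indep m vw) => y yc Ty.
  - by have [? ?] := Tw y yc Ty; split; [| |exact: Tout|exact: Tin].
  - by apply: contraL (Tnext y yc Ty) => /TnB; apply; apply: nextc.
  - by apply: Bprev; [apply: prevc | apply: Tprev].
have Bindep z z' : z \in c -> z' \in c -> B z -> B z' -> ~~ D z z'.
  apply: (alternating_indep (missesC m) wv) => y yc By.
  - have /andP[yv vy] := By; split=> //.
      by have [] := Tw _ (nextc _ yc) (Bnext y yc By).
    by have [] := Tw _ (prevc _ yc) (Bprev y yc By).
  - by apply: TnB; [apply: nextc | apply: Bnext].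
  - by apply: Tprev; [apply: prevc | apply: Bprev].
have Bw b : b \in c -> B b -> ~~ D b w /\ ~~ D w b.
  move=> bc Bb; split; apply/negP => arc.
    have /andP[_ vb2] := Tnext _ (nextc _ bc) (Bnext b bc Bb).
    by have := skipwv b bc; rewrite arc vb2.
  have /andP[vb2 _] := Tprev _ (prevc _ bc) (Bprev b bc Bb).
  have := skipvw _ (prevc _ (prevc _ bc)).
  by rewrite !next_prev // arc vb2.
pose A := [set z | (z == v) || na v z].
have Av : v \in A by rewrite inE eqxx.
have Aw : w \notin A by rewrite inE eq_sym negb_or vNw naE vw andbF.
have AT z : z \in c -> (z \in A) = T z.
  by move=> zc; rewrite inE eq_sym (negbTE (vN z zc)).
have AB z : z \in c -> z \notin A -> B z.
  by move=> zc; rewrite AT // => nT; have := TB z zc; rewrite (negbTE nT).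
have Vcase z : [\/ z = v, z = w | z \in c].
  have := spanning_mem z sp; rewrite !inE => /or3P[/eqP|/eqP|]; by constructor.
have bip x y : D x y -> (x \in A) (+) (y \in A).
  move=> xy; have [xA|xA] := boolP (x \in A); have [yA|yA] := boolP (y \in A) => //.
    have [xv|xw|xc] := Vcase x; have [yv|yw|yc] := Vcase y.
    - by move: xy; rewrite xv yv D_loopless.
    - by move: yA; rewrite yw (negbTE Aw).
    - by move: yA; rewrite AT // TE // -xv xy.
    - by move: xA; rewrite xw (negbTE Aw).
    - by move: xA; rewrite xw (negbTE Aw).
    - by move: xA; rewrite xw (negbTE Aw).
    - by move: xA; rewrite AT // TE // -yv xy andbF.
    - by move: yA; rewrite yw (negbTE Aw).
    - by have := Tindep x y xc yc; rewrite -!AT // xy => /(_ xA yA).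
  have [xv|xw|xc] := Vcase x; have [yv|yw|yc] := Vcase y.
  - by move: xA; rewrite xv Av.
  - by move: xA; rewrite xv Av.
  - by move: xA; rewrite xv Av.
  - by move: yA; rewrite yv Av.
  - by move: xy; rewrite xw yw D_loopless.
  - by have [_] := Bw y yc (AB y yc yA); rewrite -xw xy.
  - by move: yA; rewrite yv Av.
  - by have [] := Bw x xc (AB x xc xA); rewrite -yw xy.
  - by have := Bindep x y xc yc (AB x xc xA) (AB y yc yA); rewrite xy.
have cA : #|A| = #|~: A|.
  have -> : ~: A = [set z | z \notin A] by apply/setP => z; rewrite !inE.
  have -> : #|A| = #|[set z | z \in A]| by apply: eq_card => z; rewrite !inE.
  rewrite !(card_spanning _ sp) /= Av (negbTE Aw) /= !add0n add1n; congr _.+1.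
  transitivity (count T c); first by apply: eq_in_count => z zc; rewrite AT.
  rewrite cTB; apply: eq_in_count => z zc.
  apply/idP/idP => [Bz|]; last exact: AB.
  by rewrite AT //; apply: contraL Bz; apply: TnB.
have cn : #|A| + #|A| = n by rewrite {2}cA cardsC.
have outle x : outdeg D x <= #|A|.
  have [xA|xA] := boolP (x \in A).
    rewrite cA; apply/subset_leq_card/subsetP => y; rewrite inE => /bip.
    by rewrite xA in_setC.
  apply/subset_leq_card/subsetP => y; rewrite inE => /bip.
  by rewrite (negbTE xA).
have inle x : indeg D x <= #|A|.
  have [xA|xA] := boolP (x \in A).
    rewrite cA; apply/subset_leq_card/subsetP => y; rewrite inE => /bip.
    by rewrite xA in_setC addbT.
  apply/subset_leq_card/subsetP => y; rewrite inE => /bip.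
  by rewrite (negbTE xA) addbF.
have outlt x y : (x \in A) (+) (y \in A) -> ~~ D x y -> outdeg D x < #|A|.
  move=> xy nxy; have [xA|xA] := boolP (x \in A); rewrite ?xA ?(negbTE xA) /= in xy.
    rewrite cA; apply/proper_card/properP; split.
      by apply/subsetP => z; rewrite inE => /bip; rewrite xA in_setC.
    by exists y; rewrite ?in_setC // inE.
  apply/proper_card/properP; split; last by exists y; rewrite // inE.
  by apply/subsetP => z; rewrite inE => /bip; rewrite (negbTE xA).
have inlt x y : (y \in A) (+) (x \in A) -> ~~ D y x -> indeg D x < #|A|.
  move=> xy nxy; have [xA|xA] := boolP (x \in A).
    rewrite xA addbT in xy; rewrite cA; apply/proper_card/properP; split.
      by apply/subsetP => z; rewrite inE => /bip; rewrite xA in_setC addbT.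
    by exists y; rewrite ?in_setC // inE.
  rewrite (negbTE xA) addbF in xy; apply/proper_card/properP; split.
    by apply/subsetP => z; rewrite inE => /bip; rewrite (negbTE xA) addbF.
  by exists y; rewrite // inE.
have mate x : x \in A -> exists2 y, y \in A & na x y.
  move=> xA; have [y yA yx] : exists2 y, y \in A & y != x.
    have [->|xv] := eqVneq x v; last by exists v => //; rewrite eq_sym.
    by exists t0; rewrite ?AT // eq_sym vN.
  exists y => //; rewrite naE eq_sym yx /=; apply/andP.
  by split; apply/negP => /bip; rewrite xA yA.
(* An absent arc lowers an out-degree and an in-degree below [n/2]; with a non-neighbour [z] of [x]
   the sum in the condition is at most [3n - 3]. *)
have complete x y : x \in A -> y \notin A -> D x y /\ D y x.
  move=> xA yA; have [z zA nxz] := mate x xA.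
  have yx : y != x by apply: contraNneq yA => ->.
  have yz : y != z by apply: contraNneq yA => ->.
  split; apply: contraT => nxy.
    have := cond_out D_cond nxz yx yz nxy.
    have := outlt x y; rewrite xA (negbTE yA) => /(_ isT nxy).
    have := inlt y x; rewrite xA (negbTE yA) => /(_ isT nxy).
    rewrite /deg; have := inle x; have := outle z; have := inle z.
    by move: cn; vlia.
  have := cond_in D_cond nxz yx yz nxy.
  have := outlt y x; rewrite xA (negbTE yA) => /(_ isT nxy).
  have := inlt x y; rewrite xA (negbTE yA) => /(_ isT nxy).
  rewrite /deg; have := outle x; have := outle z; have := inle z.
  by move: cn; vlia.
exists A; split=> // x y.
have [xA|xA] := boolP (x \in A); have [yA|yA] := boolP (y \in A) => /=.
- by apply/negP => /bip; rewrite xA yA.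
- by have [-> _] := complete x y xA yA.
- by have [_ ->] := complete y x yA xA.
- by apply/negP => /bip; rewrite (negbTE xA) (negbTE yA).
Qed.

(* Leaving c for w, v and coming back at the first possible out-neighbour of v,
   all skipped vertices but one can be inserted into the rest of c. *)
Lemma source_false c v w : misses c v w -> D w v -> 0 < ic w c -> 0 < oc v c ->
  {in c, forall g, ~~ D v g -> 2 * size c + 1 <= dg g c + oc v c} -> False.
Proof.
move=> m wv /ic_gt0P[z zc zw] oc0 H; have [uc vc wc vw sz] := missesP m.
case: (rot_to zc) => i s E; have pE : perm_eq (z :: s) c by rewrite -E perm_rot.
have cs : cycle D (z :: s) by rewrite -E rot_cycle; case: m.
case: s E pE cs => [|e s] E pE cs.
  by have := psize pE; move: sz n_ge4; rewrite /=; vlia.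
have pz : path D e (s ++ [:: z]) by move: cs; rewrite /= cats1 => /andP[].
have [hA|nA] := boolP (has (D v) (s ++ [:: z])); last first.
  have nz : ~~ D v z.
    by apply: (hasPn nA); rewrite mem_cat mem_head orbT.
  have oc1 : oc v c <= 1.
    rewrite -(oc_perm D v pE) !oc_cons (negbTE nz).
    have -> : oc v s = 0.
      apply/eqP; rewrite -leqn0 leqNgt -has_count; apply: contra nA.
      by rewrite has_cat => ->.
    by case: (D v e).
  have := H z zc nz; have := dg_mem_le D_loopless zc.
  by move: sz n_ge4; vlia.
(* The successor [e] of [z] is given up. As [l] is the first point of return, no vertex of [X] is an
   out-neighbour of [v], so [H] applies to a stuck one. *)
have [X [l [Y [Es vl XO]]]] := split_first_has hA.
have lz : last l Y = z.
  have : last e (s ++ [:: z]) = last e (X ++ l :: Y) by rewrite Es.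
  by rewrite !last_cat.
have lY : path D l Y by move: pz; rewrite Es; path_tac.
have pc : perm_eq (e :: X ++ l :: Y) c by rewrite -Es; perm_lia.
have [P' [X' [rP' lP' pX [/andP[_ sX'] sX] stuck]]] :=
  greedy_insertion lY (leq0n (size X)).
have n0 : X' != [::].
  apply/eqP => X0; rewrite X0 cats0 in pX.
  apply: (@no_almost_spanning l P' [:: w; v] e) => //.
    by rewrite lP' lz /= zw wv vl.
  by have [_ sp] := m; span_lia.
case: stuck => [X0|stuck]; first by case: X' X0 n0 {pX sX sX'}.
case: X' n0 pX sX sX' stuck => // g X' _ pX sX sX' stuck.
have gX : g \in g :: X' by rewrite mem_head.
have le : dg g (l :: P') <= size P' + 2.
  by have := stuck g gX; do 2![case: (D _ _)] => /=; vlia.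
have pc' : perm_eq (l :: P' ++ (g :: X') ++ [:: e]) c by perm_lia.
have := stuck_dg D_loopless uc pc' gX le.
have gc : g \in c by rewrite -(perm_mem pc') !(inE, mem_cat) eqxx !orbT.
have := H g gc (XO g (sX g gX)).
have : oc v c <= size Y + 2.
  rewrite -(oc_perm D v pc) oc_cons oc_cat oc_cons.
  have -> : oc v X = 0.
    by apply/eqP; rewrite -leqn0 leqNgt -has_count; apply/hasPn => y /XO.
  by have := oc_le D v Y; have := leq_b1 (D v e); have := leq_b1 (D v l); vlia.
have := psize pc; have := psize pX.
by move: sX'; rewrite /= !size_cat /=; vlia.
Qed.

Lemma misses_mem c v w z : misses c v w -> [\/ z = v, z = w | z \in c].
Proof.
by case=> _ /spanning_mem-/(_ z); rewrite !inE => /or3P[/eqP|/eqP|]; constructor.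
Qed.

Lemma misses_out_gt0 c v w : misses c v w -> ~~ D v w -> 0 < oc v c.
Proof.
move=> m nvw; have [uc vc wc vw sz] := missesP m.
have [] := @exit_arc _ D D_strong (pred1 v) v w; rewrite /= ?eqxx 1?eq_sym //.
move=> a [b [/eqP-> bv vb]]; apply/oc_gt0P; exists b => //.
have [bv'|bw|//] := misses_mem b m; first by rewrite bv' eqxx in bv.
by rewrite -bw vb in nvw.
Qed.

Lemma misses_in_gt0 c v w : misses c v w -> ~~ D w v -> 0 < ic v c.
Proof.
move=> m nwv; have [uc vc wc vw sz] := missesP m.
have [] := @exit_arc _ D D_strong (predC1 v) w v; rewrite /= ?eqxx 1?eq_sym //.
move=> a [b [av]]; rewrite negbK => /eqP-> ab; apply/ic_gt0P; exists a => //.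
have [av'|aw|//] := misses_mem a m; first by rewrite av' eqxx in av.
by rewrite -aw ab in nwv.
Qed.

(** An in-neighbour of [v] on [c] would bring [v -> w] by [misses_double], so [v] is entered from
    [w] only. The condition at [v], [g], [w], combined with [misses_skip], is then what
    [source_false] asks for. *)
Lemma one_arc_false c v w : misses c v w -> D w v -> ~~ D v w -> False.
Proof.
move=> m wv nvw; have [uc vc wc vw sz] := missesP m.
have oc0 := misses_out_gt0 m nvw.
have iw0 : 0 < ic w c by apply: (misses_in_gt0 (missesC m)).
have ic0 : ic v c = 0.
  apply/eqP; rewrite -leqn0 leqNgt; apply/negP => ic0.
  by have := misses_double m ic0 oc0; rewrite (negbTE nvw).
apply: (source_false m wv iw0 oc0) => g gc nvg.
have ngv : ~~ D g v.
  by apply/negP => gv; move: ic0; apply/eqP; rewrite -lt0n; apply/ic_gt0P; exists g.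
have vg : v != g by apply: contraNneq vc => ->.
have wg : w != g by apply: contraNneq wc => ->.
have nvg' : na v g by rewrite naE vg nvg ngv.
have := cond_out D_cond nvg' (z := w); rewrite eq_sym vw wg => /(_ isT isT nvw).
rewrite (misses_out v m) (misses_in w m) (misses_deg v m) (misses_deg g m).
rewrite !D_loopless acxx // [ac g v]acC (na_ac nvg') /ac wv (negbTE nvw) /dg ic0.
have := misses_skip m wv; have := leq_b1 (D g w); have := leq_b1 (D w g).
by move: sz; rewrite /=; vlia.
Qed.

Lemma source_sink_false c v w : misses c v w -> D v w -> D w v ->
  ic v c = 0 -> oc w c = 0 -> False.
Proof.
move=> m vw wv ic0 oc0; have [uc vc wc vNw sz] := missesP m.
have [y yc] : exists y, y \in c.
  by case: c sz {m uc vc wc ic0 oc0} => [|y c] sz; [move: sz n_ge4; rewrite /=; vlia|exists y; rewrite mem_head].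
have nv z : z \in c -> ~~ D z v.
  by move=> zc; apply/negP => zv; move: ic0; apply/eqP; rewrite -lt0n; apply/ic_gt0P; exists z.
have nw z : z \in c -> ~~ D w z.
  by move=> zc; apply/negP => zv; move: oc0; apply/eqP; rewrite -lt0n; apply/oc_gt0P; exists z.
have iw0 : 0 < ic w c.
  have [a [b [ac' bc ab]]] := exit_arc D_strong (S := mem c) yc vc.
  apply/ic_gt0P; exists a => //; have [bv|<-//|bc'] := misses_mem b m.
    by have := nv a ac'; rewrite -bv ab.
  by move: bc; rewrite /= bc'.
have ov0 : 0 < oc v c.
  have [|a [b [ac' bc ab]]] := exit_arc D_strong (S := predC (mem c)) vc (y := y).
    by rewrite /= negbK.
  rewrite /= negbK in bc; apply/oc_gt0P; exists b => //.
  have [<-//|aw|ac''] := misses_mem a m; first by have := nw b bc; rewrite -aw ab.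
  by move: ac'; rewrite /= ac''.
apply: (source_false m wv iw0 ov0) => g gc nvg.
have vg : v != g by apply: contraNneq vc => ->.
have nvg' : na v g by rewrite naE vg nvg nv.
have key z : z \in c -> z != g -> 3 * n <= oc v c + deg D g + outdeg D z + 5.
  move=> zc zg; have zv : z != v by apply: contraNneq vc => <-.
  have := cond_in D_cond nvg' zv zg (nv z zc).
  rewrite (misses_in v m) (misses_deg v m) !D_loopless acxx // /ac vw wv /dg ic0.
  by rewrite /=; vlia.
have outz z : z \in c -> outdeg D z <= D z w + (size c).-1.
  move=> zc; rewrite (misses_out z m) (negbTE (nv z zc)) add0n leq_add2l.
  by apply: (oc_mem_le zc); rewrite D_loopless.
have degg : deg D g <= dg g c + 1.
  rewrite (misses_deg g m) [ac g v]acC (na_ac nvg') /ac (negbTE (nw g gc)).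
  by have := leq_b1 (D g w); vlia.
have := dg_mem_le D_loopless gc.
(* A [z] with no arc to [w] has small out-degree, which gives the bound for [source_false]. If all
   but [g] have such an arc, [misses_skip] leaves [v] at most one out-neighbour on [c], too few for
   [key]. *)
have [/hasP[z zc /andP[zg nzw]]|/hasPn allw] :=
    boolP (has (fun z => (z != g) && ~~ D z w) c).
  have := key z zc zg; have := outz z zc; rewrite (negbTE nzw).
  by move: sz degg; rewrite /=; vlia.
have [c' pc'] := perm_to gc.
have uc' : g \notin c' by have := perm_uniq pc'; rewrite uc => /esym /= /andP[].
have iw : size c' <= ic w c.
  rewrite (ic_perm D w pc') ic_cons; apply: leq_trans (leq_addl _ _).
  suff : all (fun y => D y w) c' by rewrite all_count => /eqP <-.
  apply/allP => z zc'; have zc : z \in c by rewrite (perm_mem pc') inE zc' orbT.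
  have zg : z != g by apply: contraNneq uc' => <-.
  by have := allw z zc; rewrite zg negbK.
have := misses_skip m wv; have szc := psize pc'.
case: c' pc' uc' iw szc => [|z c'] pc' uc' iw szc; first by move: sz n_ge4 szc; rewrite /=; vlia.
have zc : z \in c by rewrite (perm_mem pc') !inE eqxx orbT.
have zg : z != g by apply: contraNneq uc' => <-; rewrite mem_head.
have := key z zc zg; have := outz z zc; have := leq_b1 (D z w).
by move: sz degg iw szc n_ge4; rewrite /=; vlia.
Qed.

Lemma misses_bipartition c v w : misses c v w -> balanced_bipartition.
Proof.
have two c1 v1 w1 : misses c1 v1 w1 -> 0 < ic v1 c1 -> 0 < oc v1 c1 ->
    balanced_bipartition.
  move=> m ic0 oc0; have /andP[vw wv] := misses_double m ic0 oc0.
  have [r [P [us [g n0 nus]]]] := gap_exists m ic0 oc0.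
  have [u Eu] := gap_single m vw wv g n0 nus; rewrite {us}Eu in g nus {n0}.
  have [du dv] := gap_deg_le m g; have [m' g'] := gap_swap m g.
  have [/eqP dvn|dvn] := boolP (deg D v1 == n).
    exact: (full_degree_bipartition m vw wv ic0 oc0 dvn).
  have [/eqP dun|dun] := boolP (deg D u == n).
    have [_ rP /= /and3P[xu ur _] _ _] := g.
    have ic' : 0 < ic u (r :: P ++ [:: v1]).
      by apply/ic_gt0P; exists (last r P); rewrite // -cat_cons mem_cat mem_last.
    have oc' : 0 < oc u (r :: P ++ [:: v1]).
      by apply/oc_gt0P; exists r; rewrite // mem_head.
    have /andP[uw wu] := misses_double m' ic' oc'.
    exact: (full_degree_bipartition m' uw wu ic' oc' dun).
  case: (single_gap_false m vw wv g (nus u (mem_head _ _))).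
    by rewrite ltn_neqAle dvn.
  by rewrite ltn_neqAle dun.
move=> m.
have [vw|vw] := boolP (D v w); have [wv|wv] := boolP (D w v).
- have [/andP[i1 o1]|nv] := boolP ((0 < ic v c) && (0 < oc v c)).
    exact: (two c v w).
  have [/andP[i1 o1]|nw] := boolP ((0 < ic w c) && (0 < oc w c)).
    exact: (two c w v (missesC m)).
  (* Neither outside vertex has arcs both from and to [c]. By strong connectivity one of them only
     receives arcs from [c] and the other only sends arcs to it. *)
  have [uc vc wc vNw sz] := missesP m.
  have [y yc] : exists y, y \in c.
    case: c sz {m uc vc wc nv nw} => [|y c] sz; last by exists y; rewrite mem_head.
    by move: sz n_ge4; rewrite /=; vlia.
  have into : 0 < ic v c + ic w c.
    have [a [b [ac' bc ab]]] := exit_arc D_strong (S := mem c) yc vc.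
    rewrite addn_gt0; apply/orP; have [bv|bw|bc'] := misses_mem b m.
    - by left; apply/ic_gt0P; exists a; rewrite // -bv.
    - by right; apply/ic_gt0P; exists a; rewrite // -bw.
    by move: bc; rewrite /= bc'.
  have from : 0 < oc v c + oc w c.
    have [|a [b [ac' bc ab]]] := exit_arc D_strong (S := predC (mem c)) vc (y := y).
      by rewrite /= negbK.
    rewrite /= negbK in bc; rewrite addn_gt0; apply/orP.
    have [av|aw|ac''] := misses_mem a m.
    - by left; apply/oc_gt0P; exists b; rewrite // -av.
    - by right; apply/oc_gt0P; exists b; rewrite // -aw.
    by move: ac'; rewrite /= ac''.
  have [i0|i0] := posnP (ic v c).
    case: (source_sink_false m vw wv i0).
    have iw : 0 < ic w c by move: into; rewrite i0.
    by move: nw; rewrite iw /= -leqNgt leqn0 => /eqP.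
  have o0 : oc v c = 0 by move: nv; rewrite i0 /= -leqNgt leqn0 => /eqP.
  have ow : 0 < oc w c by move: from; rewrite o0.
  case: (source_sink_false (missesC m) wv vw _ o0).
  by move: nw; rewrite ow andbT -leqNgt leqn0 => /eqP.
- by case: (one_arc_false (missesC m) vw wv).
- by case: (one_arc_false m wv vw).
- exact: (two c v w m (misses_in_gt0 m wv) (misses_out_gt0 m vw)).
Qed.

End TwoOutside.

(** * Cycles missing at least three vertices *)

Section ManyOutside.

Variables (V : finType) (D : rel V).

Local Notation oc := (oc D).
Local Notation ic := (ic D).
Local Notation dg := (dg D).
Local Notation ac := (ac D).
Local Notation na := (nonadjacent D).
Local Notation n := #|V|.

Hypothesis D_loopless : irreflexive D.
Hypothesis D_cond : triple_degree_condition D.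
Hypothesis D_strong : strongly_connected D.

Variable m : nat.
Hypothesis m_ge2 : 2 <= m.
Hypothesis m_le : m + 3 <= n.
Hypothesis no_between : forall k, m < k < n -> no_cycle D k.

Lemma ac_two_path g v w : 2 < ac g w + ac v w ->
  (D g w && D w v) || (D v w && D w g).
Proof.
by rewrite /ac; case: (D g w); case: (D w g); case: (D v w); case: (D w v).
Qed.

Lemma dg_pair_le g v s : {in s, forall w, ac g w + ac v w <= 2} ->
  dg g s + dg v s <= 2 * size s.
Proof.
elim: s => // w s IHs H; rewrite !dg_cons /=.
have := H w (mem_head _ _).
have := IHs (fun z zs => H z (mem_behead (s := w :: s) zs)).
by vlia.
Qed.

(** * A bad pair that can be exchanged on the cycle *)

Section Terminal.

Variables (u v : V) (c' W : seq V).
Hypothesis cyc' : cycle D c'.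
Hypothesis sz' : size c' = m.
Hypothesis sp' : spanning (u :: W ++ c').
Hypothesis buv : bad D u v.
Hypothesis two_uv : {in W, forall w, ~~ (D u w && D w v)}.
Hypothesis two_vu : {in W, forall w, ~~ (D v w && D w u)}.
Hypothesis three_uv : forall w1 w2, w1 \in W -> w2 \in W -> w1 != w2 ->
  D u w1 -> D w1 w2 -> D w2 v -> n = m + 3.
Hypothesis three_vu : forall w1 w2, w1 \in W -> w2 \in W -> w1 != w2 ->
  D v w1 -> D w1 w2 -> D w2 u -> n = m + 3.
Hypothesis vW : v \notin W.

Let un : uniq (u :: W ++ c'). Proof. exact: spanning_uniq sp'. Qed.

Let uW : u \notin W.
Proof. by move: un; rewrite /= mem_cat negb_or => /andP[/andP[]]. Qed.
Let uc' : u \notin c'.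
Proof. by move: un; rewrite /= mem_cat negb_or => /andP[/andP[]]. Qed.
Let unc' : uniq c'.
Proof. by move: un; rewrite /= cat_uniq => /and4P[]. Qed.
Let unW : uniq W.
Proof. by move: un; rewrite /= cat_uniq => /and4P[]. Qed.
Let Wc' w : w \in W -> w \notin c'.
Proof.
move=> wW; apply/negP => wc; move: un; rewrite /= cat_uniq => /and4P[_ _ /hasPn H _].
by have := H w wc; rewrite wW.
Qed.
Let szW : size W + m + 1 = n.
Proof. by have := spanning_size sp'; rewrite /= size_cat sz'; vlia. Qed.

Let splitW w : w \in W -> exists W', [/\ perm_eq W (w :: W'), size W' + m + 2 = n,
  w \notin W' & {subset W' <= W}].
Proof.
move=> wW; have [W' pW] := perm_to wW; exists W'; split=> //.
- by have := psize pW; move: szW; rewrite /=; vlia.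
- by have := perm_uniq pW; rewrite unW => /esym /= /andP[].
- by move=> y yW; rewrite (perm_mem pW) inE yW orbT.
Qed.

Let outE z : outdeg D z = D z u + oc z W + oc z c'.
Proof. by rewrite (outdegE D z sp') oc_cons oc_cat; vlia. Qed.
Let inE' z : indeg D z = D u z + ic z W + ic z c'.
Proof. by rewrite (indegE D z sp') ic_cons ic_cat; vlia. Qed.

Let Wuv w : w \in W -> w != u /\ w != v.
Proof. by move=> wW; split; apply: contraTneq wW => ->. Qed.

(** Three vertices in place of one give length [m + 2], which is still forbidden because
    [m <= n - 3]. *)
Let skip3 a y b : uniq [:: a; y; b] -> {in [:: a; y; b], forall z, z \notin c'} ->
  D a y -> D y b -> ic a c' + oc b c' <= m.
Proof.
move=> u3 d3 ay yb; rewrite -sz'.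
apply: (@skip_bound _ D c' a [:: y; b]) => //=; first by rewrite sz'.
  by rewrite ay yb.
by rewrite sz'; apply: no_between; move: m_le; vlia.
Qed.

Let skip2 a b : a != b -> a \notin c' -> b \notin c' -> D a b ->
  ic a c' + oc b c' <= m.
Proof.
move=> aNb ac0 bc0 ab; rewrite -sz'.
apply: (@skip_bound _ D c' a [:: b]) => //=; first by rewrite sz'.
- by rewrite inE aNb.
- by move=> y; rewrite !inE => /orP[]/eqP->.
- by rewrite ab.
by rewrite sz'; apply: no_between; move: m_le; vlia.
Qed.

Let ins z : z \notin c' -> dg z c' <= m.
Proof.
move=> zc; rewrite -sz'; apply: insert_bound => //.
by rewrite sz'; apply: no_between; move: m_le; vlia.
Qed.

(** Both bad-pair inequalities hold at [w], and they fail unless outside paths [u -> y -> w] and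
    [w -> y2 -> u] exist. An arc between [v] and [w] would extend one of these to a path joining [u]
    and [v], which forces [n = m + 3]; then [W] is too small for the inequalities. *)
Lemma terminal_na w : w \in W -> na u w ->
  na v w /\ exists2 w1, w1 \in W & D u w1.
Proof.
move=> wW nuw; have [wu wv] := Wuv wW.
have := nuw; rewrite naE => /and3P[_ nuw1 nwu1].
have [W' [pW szW' wW' subW]] := splitW wW.
have ocW z : oc z W = D z w + oc z W' by rewrite (oc_perm D z pW) oc_cons.
have icW z : ic z W = D w z + ic z W' by rewrite (ic_perm D z pW) ic_cons.
have out1 : n <= oc u W' + ic w W' + (oc u c' + ic w c').
  have := bad_out D_cond buv wu wv nuw1; rewrite outE inE' ocW icW.
  by rewrite !D_loopless (negbTE nuw1) /=; vlia.
have in1 : n <= ic u W' + oc w W' + (ic u c' + oc w c').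
  have := bad_in D_cond buv wu wv nwu1; rewrite outE inE' ocW icW.
  by rewrite !D_loopless (negbTE nwu1) /=; vlia.
have uniq3 y : y \in W' -> uniq [:: w; y; u] && uniq [:: u; y; w].
  move=> yW; have [yu _] := Wuv (subW y yW).
  have yw : w != y by apply: contraNneq wW' => ->.
  by rewrite /= !inE !negb_or wu yw yu !(eq_sym u) wu yu eq_sym yw.
have dis y z : y \in W' -> z \in [:: w; y; u] -> z \notin c'.
  by move=> yW; rewrite !inE => /or3P[]/eqP-> //; apply: Wc' => //; apply: subW.
pose p1 := has (fun y => D u y && D y w) W'.
pose p2 := has (fun y => D w y && D y u) W'.
have np1 : ~~ p1 -> oc u W' + ic w W' <= size W'.
  by move=> /hasPn H; apply: count_disjoint.
have np2 : ~~ p2 -> oc w W' + ic u W' <= size W'.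
  by move=> /hasPn H; apply: count_disjoint.
have p2b : p2 -> ic w c' + oc u c' <= m.
  case/hasP=> y yW /andP[wy yu]; have /andP[u3 _] := uniq3 y yW.
  by apply: (skip3 u3) wy yu; move=> z; apply: dis.
have p1b : p1 -> ic u c' + oc w c' <= m.
  case/hasP=> y yW /andP[uy yw]; have /andP[_ u3] := uniq3 y yW.
  apply: (skip3 u3) uy yw; move=> z zz; apply: (dis y) => //.
  by move: zz; rewrite !inE => /or3P[]->; rewrite ?orbT.
have du := ins uc'; have dw := ins (Wc' wW); rewrite /dg in du dw.
have P1 : p1.
  apply: contraT => n1; have := np1 n1; have [/p2b|/np2] := boolP p2.
    by move: out1 szW'; vlia.
  by move: out1 in1 szW' du dw; vlia.
have P2 : p2.
  apply: contraT => n2; have := np2 n2; have := p1b P1.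
  by move: in1 szW'; vlia.
have t4 : n <> m + 3.
  move=> E; have := oc_le D u W'; have := ic_le D u W'; have := oc_le D w W'.
  by have := ic_le D w W'; move: out1 in1 szW' du dw; vlia.
case/hasP: P1 => y yW /andP[uy yw]; split; last by exists y => //; apply: subW.
have yNw : y != w by apply: contraNneq wW' => <-.
rewrite naE eq_sym wv /=; apply/andP; split; apply/negP => arc.
  case/hasP: P2 => y2 y2W /andP[wy2 y2u]; apply: t4.
  apply: (three_vu wW (subW _ y2W)) arc wy2 y2u.
  by apply: contraNneq wW' => ->.
by apply: t4; apply: (three_uv (subW _ yW) wW yNw uy yw arc).
Qed.

(** With no path between [u] and [v] through [w], either [w] has arcs to both and from neither, or
    the reverse. The bad-pair inequality for the absent arc at [u] then fails against [skip2] along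
    the present one. *)
Lemma terminal_adj w : w \in W -> ~~ na u w -> ~~ na v w -> False.
Proof.
move=> wW nu nv; have [wu wv] := Wuv wW.
have [W' [pW szW' wW' subW]] := splitW wW.
have ocW z : oc z W = D z w + oc z W' by rewrite (oc_perm D z pW) oc_cons.
have icW z : ic z W = D w z + ic z W' by rewrite (ic_perm D z pW) ic_cons.
have h1 := two_uv wW; have h2 := two_vu wW.
have Wc := Wc' wW.
have [wu'|nwu] := boolP (D w u).
  have nvw : ~~ D v w by apply: contra h2 => ->.
  have wv' : D w v.
    by move: nv; rewrite naE eq_sym wv nvw /= negbK.
  have nuw : ~~ D u w by apply: contra h1 => ->.
  have := bad_out D_cond buv wu wv nuw; rewrite outE inE' ocW icW.
  rewrite !D_loopless (negbTE nuw) /= => H.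
  have sk := skip2 wu Wc uc' wu'.
  have [/hasP[y yW /andP[uy yw]]|/hasPn no] := boolP (has (fun y => D u y && D y w) W').
    have yNw : y != w by apply: contraNneq wW' => <-.
    have E := three_uv (subW _ yW) wW yNw uy yw wv'.
    by have := oc_le D u W'; have := ic_le D w W'; move: H sk E szW'; vlia.
  have : oc u W' + ic w W' <= size W' by apply: count_disjoint.
  by move: H sk szW'; vlia.
have uw : D u w by move: nu; rewrite naE eq_sym wu nwu /= andbT negbK.
have nwv : ~~ D w v by move: h1; rewrite uw.
have vw : D v w by move: nv; rewrite naE eq_sym wv nwv /= andbT negbK.
have := bad_in D_cond buv wu wv nwu; rewrite outE inE' ocW icW.
rewrite !D_loopless (negbTE nwu) /= => H.
have uNw : u != w by rewrite eq_sym.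
have sk := skip2 uNw uc' Wc uw.
have [/hasP[y yW /andP[wy yu]]|/hasPn no] := boolP (has (fun y => D w y && D y u) W').
  have wNy : w != y by apply: contraNneq wW' => ->.
  have E := three_vu wW (subW _ yW) wNy vw wy yu.
  by have := oc_le D w W'; have := ic_le D u W'; move: H sk E szW'; vlia.
have : oc w W' + ic u W' <= size W' by apply: count_disjoint.
by move: H sk szW'; vlia.
Qed.

End Terminal.

(** Every vertex of [W] turns out to be non-adjacent to [u], yet non-adjacency itself yields an
    out-neighbour of [u] in [W]. *)
Lemma terminal_false u v (c c' W : seq V) :
    cycle D c -> size c = m -> spanning (v :: W ++ c) ->
    cycle D c' -> size c' = m -> spanning (u :: W ++ c') ->
    bad D u v ->
    {in W, forall w, ~~ (D u w && D w v)} -> {in W, forall w, ~~ (D v w && D w u)} ->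
    (forall w1 w2, w1 \in W -> w2 \in W -> w1 != w2 ->
      D u w1 -> D w1 w2 -> D w2 v -> n = m + 3) ->
    (forall w1 w2, w1 \in W -> w2 \in W -> w1 != w2 ->
      D v w1 -> D w1 w2 -> D w2 u -> n = m + 3) -> False.
Proof.
move=> cc sc sp cc' sc' sp' buv t1 t2 h1 h2.
have bvu : bad D v u by rewrite badC.
have uW : u \notin W by have := spanning_uniq sp'; rewrite /= mem_cat negb_or => /andP[/andP[]].
have vW : v \notin W by have := spanning_uniq sp; rewrite /= mem_cat negb_or => /andP[/andP[]].
have nau := @terminal_na u v c' W cc' sc' sp' buv h1 h2 vW.
have nav := @terminal_na v u c W cc sc sp bvu h2 h1 uW.
have adj := @terminal_adj u v c' W cc' sc' sp' buv t1 t2 h1 h2 vW.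
have main w : w \in W -> na u w.
  move=> wW; apply: contraT => nu; have [nv|nv] := boolP (na v w).
    by have [] := nav w wW nv; rewrite (negbTE nu).
  by case: (adj w wW nu nv).
case: W sp {sp' t1 t2 h1 h2 uW vW nav adj} nau main => [|w W] sp nau main.
  by have := spanning_size sp; rewrite /= sc; move: m_le; vlia.
have [_ [w1 w1W uw1]] := nau w (mem_head _ _) (main w (mem_head _ _)).
by have := main w1 w1W; rewrite naE uw1 andbF.
Qed.

(* The cycle r :: P ++ us of length m is left at the last vertex of r :: P, and
   joined again at r after the vertices Q outside the cycle; us is skipped. *)
Definition bypass r (P us Q : seq V) :=
  [/\ uniq (r :: P ++ us ++ Q), size P + size us + 1 = m,
      path D r P /\ path D (last r P) (rcons us r),
      path D (last r P) (rcons Q r) & Q != [::]].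

Lemma bypass_size r P us Q : bypass r P us Q -> m + size Q <= n.
Proof.
case=> un sz _ _ _; have [t [sp _ _]] := spanning_complement un.
have := spanning_size sp; rewrite /= !size_cat; move: sz; vlia.
Qed.

(** The rerouted cycle is longer than [m], so it can only be Hamiltonian, and then nothing was
    skipped. *)
Lemma bypass_length r P us Q : bypass r P us Q -> size us < size Q ->
  us = [::] /\ m + size Q = n.
Proof.
move=> b lt; have le := bypass_size b; have [un sz [rP rus] rQ _] := b.
have [E|ne] := eqVneq (size P + size Q + 1) n.
  case: us b lt un sz rus => [|a us] b lt un sz rus; first by split=> //; move: sz E; rewrite /=; vlia.
  by move: le sz E; rewrite /=; vlia.
have := @no_between (size P + size Q + 1) _ (r :: P ++ Q).
case.
- by move: lt sz le ne; case: ltngtP => //; vlia.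
- move: un; rewrite /= !mem_cat !negb_or => /andP[/and3P[-> _ ->]].
  rewrite !cat_uniq has_cat negb_or => /and3P[-> /andP[_ ->]] /andP[_ /andP[_ ->]].
  done.
- by rewrite cycle_catE rP rQ.
- by rewrite /= size_cat; vlia.
Qed.

(** * Bypasses with the fewest skipped vertices *)

Section MinimalBypass.

Variables (r : V) (P us Q : seq V).
Hypothesis byp : bypass r P us Q.
Hypothesis us_n0 : us != [::].
Hypothesis minimal : forall r' P' us' Q', bypass r' P' us' Q' ->
  size us' < size us -> us' = [::].

Local Notation x := (last r P).

Let un : uniq (r :: P ++ us ++ Q). Proof. by case: byp. Qed.
Let sz : size P + size us + 1 = m. Proof. by case: byp. Qed.
Let rP : path D r P. Proof. by case: byp => _ _ []. Qed.
Let rus : path D x (rcons us r). Proof. by case: byp => _ _ []. Qed.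
Let rQ : path D x (rcons Q r). Proof. by case: byp. Qed.
Let Qn0 : Q != [::]. Proof. by case: byp. Qed.
Let C := r :: P ++ us.

Let uC : uniq C.
Proof. by move: un; rewrite catA -cat_cons cat_uniq => /and3P[]. Qed.

(** A bypass skipping fewer vertices skips none and so uses all the outside vertices. As there are
    at least three, this excludes detours of one or two vertices, and detours of three force
    [n = m + 3]. *)
Let minimal_length r' P' us' Q' : bypass r' P' us' Q' -> size us' < size us ->
  us' = [::] /\ m + size Q' = n.
Proof.
move=> b lt; have E := minimal b lt; apply: (bypass_length b).
by rewrite E; case: b => _ _ _ _; case: Q'.
Qed.

Let disjoint_uniq Q' : uniq Q' -> {in Q', forall z, z \notin C} -> uniq (C ++ Q').
Proof. by move=> uQ dQ; rewrite cat_uniq uC uQ andbT; apply/hasPn. Qed.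

Let from_u us1 u us2 Q' : us = us1 ++ u :: us2 -> uniq Q' ->
    {in Q', forall z, z \notin C} -> Q' != [::] -> path D u (rcons Q' r) ->
  us2 = [::] /\ m + size Q' = n.
Proof.
move=> E uQ' dQ' n0 uQr.
have := disjoint_uniq uQ' dQ'; rewrite /C E => un'.
apply: (@minimal_length r (P ++ us1 ++ [:: u]) us2 Q'); last first.
  by rewrite E size_cat /=; vlia.
split=> //.
- by rewrite (@perm_uniq _ _ ((r :: P ++ us1 ++ u :: us2) ++ Q')) //; perm_lia.
- by move: sz; rewrite E !size_cat /=; vlia.
- rewrite !last_cat /=; move: rus; rewrite E; split; last by move: rus; rewrite E; path_tac.
  by move: rus rP; rewrite E; path_tac.
- by rewrite !last_cat.
Qed.

Let to_u us1 u us2 Q' : us = us1 ++ u :: us2 -> uniq Q' ->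
    {in Q', forall z, z \notin C} -> Q' != [::] -> path D x (rcons Q' u) ->
  us1 = [::] /\ m + size Q' = n.
Proof.
move=> E uQ' dQ' n0 xQu.
have := disjoint_uniq uQ' dQ'; rewrite /C E => un'.
apply: (@minimal_length u (us2 ++ r :: P) us1 Q'); last first.
  by rewrite E size_cat /=; vlia.
split=> //.
- by rewrite (@perm_uniq _ _ ((r :: P ++ us1 ++ u :: us2) ++ Q')) //; perm_lia.
- by move: sz; rewrite E !size_cat /=; vlia.
- rewrite !last_cat /=; split; last by move: rus; rewrite E; path_tac.
  by move: rus rP; rewrite E; path_tac.
- by rewrite !last_cat.
Qed.

Let QC z : z \in Q -> z \notin C.
Proof.
move=> zQ; move: un; rewrite catA -cat_cons cat_uniq => /and3P[_ /hasPn H _].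
exact: H.
Qed.
Let uQ : uniq Q.
Proof. by move: un; rewrite catA -cat_cons cat_uniq => /and3P[]. Qed.
Let sQ : m + size Q <= n. Proof. exact: bypass_size byp. Qed.

Let Q_le_us : size Q <= size us.
Proof.
rewrite leqNgt; apply/negP => lt; have [E _] := bypass_length byp lt.
by move: us_n0; rewrite E.
Qed.

Let short_cycle r' P' Q' : path D r' P' -> path D (last r' P') (rcons Q' r') ->
  uniq (r' :: P' ++ Q') -> m < size P' + size Q' + 1 < n -> False.
Proof.
move=> p1 p2 u3 lt; apply: (no_between lt (c := r' :: P' ++ Q')) => //.
  by rewrite cycle_catE p1 p2.
by rewrite /= size_cat; vlia.
Qed.

Let stuck : exists P' X' : seq V,
  [/\ path D r P', last r P' = x, perm_eq (P' ++ X') (P ++ us),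
      size Q <= size X' <= size us & {subset X' <= us} /\
      forall g, g \in X' -> dg g C + 1 <= m + size X'].
Proof.
(* With exactly [size Q - 1] vertices left over, [Q] in their place would give length [m + 1]; so at
   least [size Q] are stuck. *)
have k1 : (size Q).-1 <= size us by move: Q_le_us; vlia.
have [P' [X' [rP' lP' pX [/andP[l2 sX'] sX] stuck]]] := greedy_insertion rP k1.
have szX := psize pX; rewrite !size_cat in szX.
have neq : size X' <> (size Q).-1.
  move=> E; apply: (@short_cycle r P' Q) => //; first by rewrite lP'.
    have : uniq ((r :: P' ++ Q) ++ X').
      by rewrite (@perm_uniq _ _ (r :: P ++ us ++ Q)) //; perm_lia.
    by rewrite cat_uniq => /and3P[].
  have : 0 < size Q by case: Q Qn0.
  by move: szX sz m_le E l2; vlia.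
case: stuck => // stuck; exists P', X'; split=> //; first by move: sX' l2 neq; vlia.
split=> // g gX.
have le : dg g (r :: P') <= size P' + 2.
  by have := stuck g gX; do 2![case: (D _ _)] => /=; vlia.
have pC : perm_eq (r :: P' ++ X' ++ [::]) C by rewrite /C; perm_lia.
have := stuck_dg D_loopless uC pC gX le.
by move: szX sz; rewrite /=; vlia.
Qed.

Let O_spec : exists O, [/\ spanning (C ++ O), size O + m = n &
  forall z, (z \in O) = (z \notin C)].
Proof.
have [O [sp _ mO]] := spanning_complement uC; exists O; split=> //.
by have := spanning_size sp; rewrite /C /= !size_cat; move: sz; vlia.
Qed.

(** On the cycle the two bounds add up to [2m], and each outside vertex other than [v] adds at most
    2: [2m + 2(n - m - 1) = 2n - 2]. *)
Let bad_pair g v : dg g C + 1 <= m + size us -> dg v C <= size P + 2 ->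
    v \notin C -> na g v ->
    (forall w, w \notin C -> ac g w + ac v w <= 2) -> bad D g v.
Proof.
move=> lg lv vC ngv lw; rewrite /bad ngv /=.
have [O [sp szO mO]] := O_spec.
rewrite (degE D g sp) (degE D v sp) !dg_cat.
have vO : v \in O by rewrite mO.
have [O' pO] := perm_to vO; have szO' := psize pO.
rewrite !(dg_perm D _ pO) (dg_cons D g v) (dg_cons D v v) acxx // (na_ac ngv).
have : dg g O' + dg v O' <= 2 * size O'.
  apply: dg_pair_le => w wO; apply: lw; rewrite -mO (perm_mem pO) inE wO orbT //.
by move: lg lv sz szO szO'; rewrite /=; vlia.
Qed.

Let usC u : u \in us -> u \in C.
Proof. by move=> uu; rewrite /C inE mem_cat uu !orbT. Qed.

Let neqC u z : u \in C -> z \notin C -> u != z.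
Proof. by move=> uu; apply: contraNneq => <-. Qed.

Let to_single v us1 u us2 : us = us1 ++ u :: us2 -> v \notin C -> D x v -> ~~ D v u.
Proof.
move=> E vC xv; apply/negP => vu.
have [] := to_u E (Q' := [:: v]) => //=.
- by move=> z; rewrite inE => /eqP->.
- by rewrite xv vu.
by move=> _; move: m_le; vlia.
Qed.

Let from_single v us1 u us2 : us = us1 ++ u :: us2 -> v \notin C -> D v r -> ~~ D u v.
Proof.
move=> E vC vr; apply/negP => uv.
have [] := from_u E (Q' := [:: v]) => //=.
- by move=> z; rewrite inE => /eqP->.
- by rewrite uv vr.
by move=> _; move: m_le; vlia.
Qed.

Let pair_uniq (a b : V) : D a b -> uniq [:: a; b].
Proof. by move=> ab; rewrite /= inE andbT; apply: contraTneq ab => ->; rewrite D_loopless. Qed.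

Let to_double v w us1 u us2 : us = us1 ++ u :: us2 -> v \notin C -> w \notin C ->
  D x v -> ~~ (D v w && D w u).
Proof.
move=> E vC wC xv; apply/negP => /andP[vw wu].
have [] := to_u E (pair_uniq vw) => //=.
- by move=> z; rewrite !inE => /orP[]/eqP->.
- by rewrite xv vw wu.
by move=> _; move: m_le; vlia.
Qed.

Let from_double v w us1 u us2 : us = us1 ++ u :: us2 -> v \notin C -> w \notin C ->
  D v r -> ~~ (D u w && D w v).
Proof.
move=> E vC wC vr; apply/negP => /andP[uw wv].
have [] := from_u E (pair_uniq wv) => //=.
- by move=> z; rewrite !inE => /orP[]/eqP->.
- by rewrite uw wv vr.
by move=> _; move: m_le; vlia.
Qed.

Section Ends.

Variables (v1 : V) (Q1 : seq V) (Q2 : seq V) (v2 : V).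
Hypothesis EQ1 : Q = v1 :: Q1.
Hypothesis EQ2 : Q = rcons Q2 v2.

Let v1C : v1 \notin C. Proof. by apply: QC; rewrite EQ1 mem_head. Qed.
Let v2C : v2 \notin C. Proof. by apply: QC; rewrite EQ2 mem_rcons mem_head. Qed.
Let xv1 : D x v1. Proof. by move: rQ; rewrite EQ1 => /andP[]. Qed.
Let v2r : D v2 r. Proof. by move: rQ; rewrite EQ2 rcons_path last_rcons => /andP[]. Qed.

Let v1_out us1 u us2 : us = us1 ++ u :: us2 -> ~~ D v1 u.
Proof. by move=> E; apply: (to_single E v1C xv1). Qed.
Let v2_in us1 u us2 : us = us1 ++ u :: us2 -> ~~ D u v2.
Proof. by move=> E; apply: (from_single E v2C v2r). Qed.
Let v1_in us1 u us2 : us = us1 ++ u :: us2 -> us2 != [::] -> ~~ D u v1.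
Proof.
move=> E n0; apply/negP => uv; case/eqP: n0.
have [] // := from_u E uQ QC Qn0 _.
by move: rQ; rewrite EQ1 /= uv => /andP[].
Qed.
Let v2_out us1 u us2 : us = us1 ++ u :: us2 -> us1 != [::] -> ~~ D v2 u.
Proof.
move=> E n0; apply/negP => vu; case/eqP: n0.
have [] // := to_u E uQ QC Qn0 _.
by move: rQ; rewrite EQ2 !rcons_path last_rcons vu => /andP[->].
Qed.

(** Among the skipped vertices only the last, [z], can be adjacent to [v1], and only by [z -> v1].
    So [v1] is tested on the path [z :: r :: P]; fitting in there would give length [m + 1]. *)
Let dg_v1 : dg v1 C <= size P + 2.
Proof.
have [us0 [z E]] : exists us0 z, us = us0 ++ [:: z].
  by case/lastP: us us_n0 => // us0 z _; exists us0, z; rewrite cats1.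
have pC : perm_eq C ((z :: r :: P) ++ us0) by rewrite /C E; perm_lia.
have uz : ~~ D v1 z by apply: (@v1_out us0 z [::]).
rewrite (dg_perm D v1 pC) dg_cat [dg v1 us0]dg0 ?addn0; last first.
  move=> y /splitPr yus; case: yus E => a b; rewrite -catA /= => E.
  rewrite /ac (negbTE (v1_out E)) (negbTE (v1_in E _)) //.
  by case: (b).
rewrite leqNgt; apply/negP => lt.
have pz : path D z (r :: P) by move: rus rP; rewrite E; path_tac.
have [|P1 [p1 l1 q1]] := insert_path (z := v1) pz.
  by rewrite (negbTE uz) /=; have := leq_b1 (D x v1); move: lt; vlia.
apply: (@short_cycle z P1 us0) => //.
- by rewrite l1 /=; move: rus; rewrite E; path_tac.
- rewrite (@perm_uniq _ _ (v1 :: C)); first by rewrite /= v1C.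
  perm_lia.
- have := psize q1; move: sz m_le; rewrite E size_cat /=; vlia.
Qed.

Let dg_v2 : dg v2 C <= size P + 2.
Proof.
have [z [us0 E]] : exists z us0, us = z :: us0.
  by case: us us_n0 => // z us0 _; exists z, us0.
have pC : perm_eq C ((r :: P ++ [:: z]) ++ us0) by rewrite /C E; perm_lia.
have uz : ~~ D z v2 by apply: (@v2_in [::] z us0).
rewrite (dg_perm D v2 pC) dg_cat [dg v2 us0]dg0 ?addn0; last first.
  move=> y /splitPr yus; case: yus E => a b E.
  by rewrite /ac (negbTE (@v2_in (z :: a) y b E)) (negbTE (@v2_out (z :: a) y b E _)).
rewrite leqNgt; apply/negP => lt.
have pz : path D r (P ++ [:: z]) by move: rus rP; rewrite E; path_tac.
have [|P1 [p1 l1 q1]] := insert_path (z := v2) pz.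
  rewrite last_cat /= (negbTE uz) size_cat /=.
  by have := leq_b1 (D v2 r); move: lt; vlia.
apply: (@short_cycle r P1 us0) => //.
- by rewrite l1 last_cat /=; move: rus; rewrite E; path_tac.
- rewrite (@perm_uniq _ _ (v2 :: C)); first by rewrite /= v2C.
  perm_lia.
- have := psize q1; move: sz m_le; rewrite E /= size_cat /=; vlia.
Qed.

(** A path [u -> w -> v1] would continue along [Q] to [r] (from [w] itself if [w] is on [Q]) and
    skip only [us2], so by minimality nothing. Paths [v1 -> w -> u] are excluded by [to_double]. *)
Let bad_v1 us1 u us2 : us = us1 ++ u :: us2 -> dg u C + 1 <= m + size us ->
  us2 != [::] -> bad D u v1.
Proof.
move=> E le n0; have uus : u \in us by rewrite E mem_cat mem_head orbT.
apply: bad_pair => //.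
  by rewrite naE (neqC (usC uus) v1C) (v1_in E n0) (v1_out E).
move=> w wC; rewrite leqNgt; apply/negP => /ac_two_path /orP[/andP[uw wv]|two].
  case/eqP: n0; have [wQ|wQ] := boolP (w \in Q).
    have [q1 [q2 EQ]] : exists q1 q2, Q = q1 ++ w :: q2.
      by case/splitPr: wQ => q1 q2; exists q1, q2.
    have [] // := @from_u us1 u us2 (w :: q2) E.
    - by move: uQ; rewrite EQ cat_uniq => /and3P[].
    - by move=> z zQ; apply: QC; rewrite EQ mem_cat zQ orbT.
    - by move: rQ; rewrite EQ; path_tac.
  have [] // := @from_u us1 u us2 (w :: Q) E.
  - by rewrite /= wQ.
  - by move=> z; rewrite inE => /orP[/eqP->|/QC].
  - by move: rQ; rewrite EQ1; path_tac.
by have := to_double E v1C wC xv1; rewrite two.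
Qed.

Let bad_v2 us1 u us2 : us = us1 ++ u :: us2 -> dg u C + 1 <= m + size us ->
  us1 != [::] -> bad D u v2.
Proof.
move=> E le n0; have uus : u \in us by rewrite E mem_cat mem_head orbT.
apply: bad_pair => //.
  by rewrite naE (neqC (usC uus) v2C) (v2_in E) (v2_out E n0).
move=> w wC; rewrite leqNgt; apply/negP => /ac_two_path /orP[two|/andP[vw wu]].
  by have := from_double E v2C wC v2r; rewrite two.
case/eqP: n0; have [wQ|wQ] := boolP (w \in Q).
  have [q1 [q2 EQ]] : exists q1 q2, Q = q1 ++ w :: q2.
    by case/splitPr: wQ => q1 q2; exists q1, q2.
  have [] // := @to_u us1 u us2 (rcons q1 w) E.
  - by move: uQ; rewrite EQ -cat_rcons cat_uniq => /and3P[].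
  - by move=> z zQ; apply: QC; rewrite EQ -cat_rcons mem_cat zQ.
  - by case: (q1).
  - by move: rQ; rewrite EQ; path_tac.
have [] // := @to_u us1 u us2 (rcons Q w) E.
- by rewrite rcons_uniq wQ.
- by move=> z; rewrite mem_rcons inE => /orP[/eqP->|/QC].
- by case: (Q).
- by move: rQ; rewrite EQ2; path_tac.
Qed.

Lemma minimal_bypass_long : 2 <= size Q -> False.
Proof.
move=> Q2'; have [P' [X' [rP' lP' pX /andP[QX Xus] [sX le]]]] := stuck.
have uX : uniq X'.
  have : uniq (r :: P' ++ X') by rewrite (@perm_uniq _ _ C) // /C; perm_lia.
  by rewrite /= cat_uniq => /and4P[].
have v12 : v1 != v2.
  apply/eqP => v12; move: uQ Q2'; rewrite EQ2; case: Q2 EQ2 => // q Q3; rewrite EQ1.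
  by case=> <- _; rewrite /= v12 mem_rcons mem_head.
have le' g : g \in X' -> dg g C + 1 <= m + size us.
  by move=> gX; have := le g gX; move: Xus; vlia.
have [a [us0 Ea]] : exists a us0, us = a :: us0.
  by case: us us_n0 => // a us0 _; exists a, us0.
have [us3 [z Ez]] : exists us3 z, us = us3 ++ [:: z].
  by case/lastP: us us_n0 => // us3 z _; exists us3, z; rewrite cats1.
(* A stuck vertex strictly inside the gap would be bad with both [v1] and [v2]. *)
have ends g : g \in X' -> g \in [:: a; z].
  move=> gX; have [us1 [us2 E]] : exists us1 us2, us = us1 ++ g :: us2.
    by case/splitPr: (sX g gX) => us1 us2; exists us1, us2.
  have [E1|n1] := eqVneq us1 [::].
    by move: Ea; rewrite E E1 => -[->]; rewrite mem_head.
  have [E2|n2] := eqVneq us2 [::].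
    move: Ez; rewrite E E2 => /(congr1 (last a)); rewrite !last_cat /= => ->.
    by rewrite !inE eqxx orbT.
  have := bad_unique D_cond (bad_v1 E (le' g gX) n2) (bad_v2 E (le' g gX) n1).
  by move/eqP; rewrite eq_sym (negbTE v12).
have szX : size X' <= 2 by apply: (uniq_leq_size uX ends).
have az : a != z.
  apply/eqP => E; have : size X' <= size [:: a].
    by apply: uniq_leq_size => // g /ends; rewrite -E !inE orbb.
  by move: QX Q2'; rewrite /=; vlia.
have pX' : perm_eq X' [:: a; z].
  apply: subset_size_perm => //; first by rewrite /= inE az.
  by move: QX Q2'; rewrite /=; vlia.
have aX : a \in X' by rewrite (perm_mem pX') mem_head.
have zX : z \in X' by rewrite (perm_mem pX') !inE eqxx orbT.
have EQ : Q = [:: v1; v2].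
  have : size Q = 2 by move: QX szX Q2'; vlia.
  move: EQ2; rewrite EQ1; case: Q1 => [|q [|q' q'']] //.
  case: Q2 => [|b [|b' b'']] //; last by case: b''.
  by case=> _ ->.
have Ea' : us = [::] ++ a :: us0 by [].
have us0n : us0 != [::].
  apply/eqP => E0; move: Ez; rewrite Ea E0; case: us3 => [[az'] |? []] //.
  by rewrite az' eqxx in az.
have us3n : us3 != [::].
  by apply/eqP => E0; move: Ez; rewrite Ea E0; case=> az'; rewrite az' eqxx in az.
have b1 := bad_v1 Ea' (le' a aX) us0n; have b2 := bad_v2 Ez (le' z zX) us3n.
have aC : a \in C by apply: usC; rewrite Ea mem_head.
have zC : z \in C by apply: usC; rewrite Ez mem_cat mem_head orbT.
have v2a : ~~ D v2 a.
  apply/negP => v2a; have [] := to_u Ea' uQ QC Qn0 _.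
    by move: rQ; rewrite EQ /= v2a => /and3P[-> ->].
  by move=> _; rewrite EQ; move: m_le; rewrite /=; vlia.
have zv1 : ~~ D z v1.
  apply/negP => zv1; have [] := from_u Ez uQ QC Qn0 _.
    by move: rQ; rewrite EQ /= zv1 => /and3P[_ -> ->].
  by move=> _; rewrite EQ; move: m_le; rewrite /=; vlia.
have v1v2 : D v1 v2 by move: rQ; rewrite EQ => /and3P[].
have [O [sp szO mO]] := O_spec.
(* Without short outside paths linking [a] to [v2] and [z] to [v1], one of [a], [z] would get a
   second bad partner. *)
have [/hasP[w wO aw]|/hasPn no] := boolP (has (fun w => 2 < ac a w + ac v2 w) O); last first.
  have b3 : bad D a v2.
    apply: bad_pair => //; first exact: le'.
      by rewrite naE (neqC aC v2C) (v2_in Ea') v2a.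
    by move=> w wC; rewrite leqNgt no // mO.
  by have /eqP := bad_unique D_cond b1 b3; rewrite eq_sym (negbTE v12).
have [/hasP[w' w'O zw]|/hasPn no] := boolP (has (fun w => 2 < ac z w + ac v1 w) O); last first.
  have b3 : bad D z v1.
    apply: bad_pair => //; first exact: le'.
      by rewrite naE (neqC zC v1C) zv1 (v1_out Ez).
    by move=> w' wC; rewrite leqNgt no // mO.
  by have /eqP := bad_unique D_cond b2 b3; rewrite (negbTE v12).
have wC : w \notin C by rewrite -mO.
have wC' : w' \notin C by rewrite -mO.
have /andP[v2w wa] : D v2 w && D w a.
  by case/orP: (ac_two_path aw) => // two; have := from_double Ea' v2C wC v2r; rewrite two.
have /andP[zw' w'v1] : D z w' && D w' v1.
  by case/orP: (ac_two_path zw) => // two; have := to_double Ez v1C wC' xv1; rewrite two.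
have wv1 : w != v1 by apply: contraTneq wa => ->; apply: (v1_out Ea').
have wv2 : w != v2 by apply: contraTneq v2w => ->; rewrite D_loopless.
(* The detour [v1], [v2], [w] returns at [a], the successor of the vertex it left, and skips
   nothing; so no other outside vertex exists. *)
have t3 : m + 3 = n.
  have [] := @to_u _ _ _ [:: v1; v2; w] Ea' => //.
  - by rewrite /= !inE !negb_or v12 eq_sym wv1 eq_sym wv2.
  - by move=> y; rewrite !inE => /or3P[]/eqP->.
  - by rewrite /= xv1 v1v2 v2w wa.
have ww' : w' = w.
  have pO : perm_eq [:: v1; v2; w] O.
    apply: subset_size_perm.
    - by rewrite /= !inE !negb_or v12 eq_sym wv1 eq_sym wv2.
    - by have := spanning_uniq sp; rewrite cat_uniq => /and3P[].
    - by move=> y; rewrite mO !inE => /or3P[]/eqP->.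
    - by rewrite /=; move: szO t3; vlia.
  move: w'O; rewrite -(perm_mem pO) !inE => /or3P[]/eqP // E.
    by rewrite E D_loopless in w'v1.
  by have := v2_in Ez; rewrite -E zw'.
rewrite ww' in zw' w'v1.
have naw : ~~ D a w.
  apply/negP => aw'; case/eqP: us0n.
  have [] // := @from_u _ _ _ [:: w; v1; v2] Ea'.
  - by rewrite /= !inE !negb_or v12 wv1 wv2.
  - by move=> y; rewrite !inE => /or3P[]/eqP->.
  - by rewrite /= aw' w'v1 v1v2 v2r.
have nwv2 : ~~ D w v2.
  by have := from_double Ez v2C wC v2r; rewrite zw'.
move: aw; rewrite /ac (negbTE naw) (negbTE nwv2).
by have := leq_b1 (D w a); have := leq_b1 (D v2 w); vlia.
Qed.

End Ends.

(** No vertex of the gap is adjacent to [v], so every stuck vertex is bad with [v], and there is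
    just one, [u]. The others fit into the path, so [u] and [v] can be exchanged; minimality
    supplies the path restrictions of [terminal_false]. *)
Lemma minimal_bypass_short v : Q = [:: v] -> False.
Proof.
move=> EQ; have vC : v \notin C by apply: QC; rewrite EQ mem_head.
have /and3P[xv vr _] : [&& D x v, D v r & true] by move: rQ; rewrite EQ.
have split_us u : u \in us -> exists us1 us2, us = us1 ++ u :: us2.
  by case/splitPr=> us1 us2; exists us1, us2.
have nav u : u \in us -> na u v.
  move=> uus; have [us1 [us2 E]] := split_us u uus.
  by rewrite naE (neqC (usC uus) vC) (from_single E vC vr) (to_single E vC xv).
have dv : dg v C <= size P + 2.
  rewrite /C -cat_cons dg_cat [dg v us]dg0 ?addn0; last first.
    by move=> y /nav; rewrite acC => /na_ac.
  rewrite leqNgt; apply/negP => lt.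
  have [|P1 [p1 l1 q1]] := insert_path (z := v) rP.
    by rewrite xv vr; move: lt; vlia.
  apply: (@short_cycle r P1 us) => //; first by rewrite l1.
    rewrite (@perm_uniq _ _ (v :: C)); first by rewrite /= vC.
    by rewrite /C; perm_lia.
  by have := psize q1; move: sz m_le; rewrite /=; vlia.
have [P' [X' [rP' lP' pX /andP[QX Xus] [sX le]]]] := stuck.
have uX : uniq X'.
  have : uniq (r :: P' ++ X') by rewrite (@perm_uniq _ _ C) // /C; perm_lia.
  by rewrite /= cat_uniq => /and4P[].
have badX g : g \in X' -> bad D g v.
  move=> gX; have [us1 [us2 E]] := split_us g (sX g gX).
  apply: bad_pair => //; first by have := le g gX; move: Xus; vlia.
    by apply: nav; apply: sX.
  move=> w wC; rewrite leqNgt; apply/negP => /ac_two_path /orP[] two.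
    by have := from_double E vC wC vr; rewrite two.
  by have := to_double E vC wC xv; rewrite two.
case: X' QX pX Xus sX le uX badX => [|u X'] QX pX Xus sX le uX badX.
  by move: QX; rewrite EQ.
have buv : bad D u v by apply: badX; rewrite mem_head.
have {uX} X0 : X' = [::].
  case: X' uX badX {QX pX Xus sX le} => // g X' uX badX.
  have : g = u.
    apply: (bad_unique D_cond (x := v)); rewrite badC //; apply: badX.
    by rewrite !inE eqxx orbT.
  by move=> gu; move: uX; rewrite gu /= inE eqxx.
rewrite {}X0 in pX QX Xus sX le badX.
have uus : u \in us by apply: sX; rewrite mem_head.
have [us1 [us2 E]] := split_us u uus.
have [O [sp szO mO]] := O_spec.
have vO : v \in O by rewrite mO.
have [W pO] := perm_to vO.
have uO : uniq O by have := spanning_uniq sp; rewrite cat_uniq => /and3P[].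
have vW : v \notin W by have := perm_uniq pO; rewrite uO /= => /esym /andP[].
have WC w : w \in W -> w \notin C by move=> wW; rewrite -mO (perm_mem pO) inE wW orbT.
have WNv w : w \in W -> w != v by move=> wW; apply: contraNneq vW => <-.
have szX := psize pX; rewrite !size_cat /= in szX.
apply: (@terminal_false u v C (r :: P' ++ [:: v]) W) => //.
- by rewrite /C cycle_catE rP rus.
- by rewrite /C /= size_cat; move: sz; vlia.
- by rewrite /C in sp *; span_lia.
- by rewrite cycle_catE rP' lP' /= xv vr.
- by rewrite /= size_cat /=; move: sz szX; vlia.
- by rewrite /C in sp; span_lia.
- by move=> w wW; apply: (from_double E vC (WC w wW) vr).
- by move=> w wW; apply: (to_double E vC (WC w wW) xv).
- move=> w1 w2 w1W w2W w12 uw1 ww w2v.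
  have [] // := @from_u us1 u us2 [:: w1; w2; v] E.
  + by rewrite /= !inE !negb_or w12 !WNv.
  + by move=> y; rewrite !inE => /or3P[]/eqP-> //; apply: WC.
  + by rewrite /= uw1 ww w2v vr.
- move=> w1 w2 w1W w2W w12 vw1 ww w2u.
  have [] // := @to_u us1 u us2 [:: v; w1; w2] E.
  + by rewrite /= !inE !negb_or w12 ![v == _]eq_sym !WNv.
  + by move=> y; rewrite !inE => /or3P[]/eqP-> //; apply: WC.
  + by rewrite /= xv vw1 ww w2u.
Qed.

End MinimalBypass.

(** * Excluding cycles that miss three or more vertices *)

Lemma no_bypass r P us Q : bypass r P us Q -> us != [::] -> False.
Proof.
have [k] := ubnP (size us); elim: k r P us Q => // k IHk r P us Q lt b n0.
have minimal r' P' us' Q' : bypass r' P' us' Q' -> size us' < size us -> us' = [::].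
  move=> b' lt'; apply/eqP; apply: contraT => n0'.
  by case: (IHk r' P' us' Q') => //; move: lt lt'; vlia.
have [_ _ _ _ Qn0] := b; case: Q b Qn0 => // v1 Q1 b _.
case: Q1 b => [|q Q1] b; first exact: (minimal_bypass_short b n0 minimal erefl).
apply: (@minimal_bypass_long r P us _ b n0 minimal v1 (q :: Q1)
  (belast v1 (q :: Q1)) (last v1 (q :: Q1)) erefl _ isT).
exact: lastI.
Qed.

(** With bypasses excluded, a detour returns at the successor of its starting vertex and exhausts
    the outside. So arcs from the cycle reach only the first vertex of [Q] and arcs back leave only
    its last; an interior vertex of [Q] is then bad with every cycle vertex. *)
Lemma no_short_longest_cycle c : uniq c -> cycle D c -> size c = m -> False.
Proof.
move=> uc cc sc.
have [y0 y0c] : exists y, y \in c.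
  by case: c sc {uc cc} => [|y c] sc; [move: m_ge2; rewrite -sc | exists y; rewrite mem_head].
have [z0 z0c] : exists z, z \notin c.
  have [t [sp _ mt]] := spanning_complement uc; case: t sp mt => [|z t] sp mt.
    by have := spanning_size sp; rewrite cats0 sc; move: m_le; vlia.
  by exists z; rewrite -mt mem_head.
have [a [q [ac0 qc aq]]] := exit_arc D_strong (S := mem c) y0c z0c.
have qa : q != a by apply: contraNneq qc => ->.
have /connectP[p0 qp0 lp0] := D_strong qa.
case: (shortenP qp0) lp0 => p qp up _ lp {p0 qp0}.
have hp : has (mem c) p.
  case: p lp {qp up} => [E|y p lp]; first by move: qa; rewrite E eqxx.
  by apply/hasP; exists a => //; rewrite lp /= mem_last.
have [s1 [r [s2 [Ep rc s1c]]]] := split_first_has hp.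
pose Q := q :: s1.
have QC z : z \in Q -> z \notin c by rewrite inE => /orP[/eqP->|/s1c].
have uQ : uniq Q.
  by move: up; rewrite Ep -cat_cons cat_uniq => /and3P[].
have aQr : path D a (rcons Q r) by rewrite /Q /= aq; move: qp; rewrite Ep; path_tac.
case: (rot_to rc) => i s E; have pE : perm_eq (r :: s) c by rewrite -E perm_rot.
have cs : cycle D (r :: s) by rewrite -E rot_cycle.
have splitC z : z \in c -> exists P us, [/\ s = P ++ us, last r P = z & us = [::] -> z = last r s].
  rewrite -(perm_mem pE) inE => /orP[/eqP->|].
    by exists [::], s; split=> // ->.
  case/splitPr=> s3 s4; exists (rcons s3 z), s4.
  by rewrite cat_rcons last_rcons last_cat /=; split=> // ->.
have mk z Q' : z \in c -> {subset Q' <= Q} -> uniq Q' -> Q' != [::] ->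
    path D z (rcons Q' r) -> z != last r s -> False.
  move=> zc sQ uQ' n0 zQ zl; have [P [us [Es lP u0]]] := splitC z zc.
  apply: (@no_bypass r P us Q'); last by apply: contra zl => /eqP /u0 ->.
  have uPQ : uniq (c ++ Q').
    by rewrite cat_uniq uc uQ' andbT; apply/hasPn => y /sQ /QC.
  rewrite Es in pE cs; split=> //.
  - by rewrite (@perm_uniq _ _ (c ++ Q')) //; perm_lia.
  - by have := psize pE; rewrite /= size_cat sc; vlia.
  - by move: cs; rewrite cycle_catE => /andP[].
  - by rewrite lP.
have aE : a = last r s.
  apply/eqP; apply: contraT => al.
  by case: (mk a Q ac0 _ uQ) => //.
have xr : D (last r s) r by move: cs; rewrite /= rcons_path => /andP[].
have rs : path D r s by move: cs; rewrite /= rcons_path => /andP[].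
have mk2 z Q' : z \in c -> {subset Q' <= Q} -> uniq Q' -> Q' != [::] ->
    path D a (rcons Q' z) -> z != r -> False.
  move=> zc sQ uQ' n0 aQz zr.
  have zs : z \in s by move: zc; rewrite -(perm_mem pE) inE (negbTE zr).
  have [s3 [s4 Es]] : exists s3 s4, s = s3 ++ z :: s4.
    by case/splitPr: zs => s3 s4; exists s3, s4.
  have uPQ : uniq (c ++ Q').
    by rewrite cat_uniq uc uQ' andbT; apply/hasPn => y /sQ /QC.
  have lx : last z s4 = a by rewrite aE Es last_cat.
  have px : path D (last r s) (r :: s) by rewrite /= xr rs.
  apply: (@no_bypass z s4 (r :: s3) Q') => //; split=> //.
  - by rewrite (@perm_uniq _ _ (c ++ Q')) //; rewrite Es in pE; perm_lia.
  - by have := psize pE; rewrite Es /= size_cat sc /=; vlia.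
  - by rewrite lx aE; split; move: px; rewrite Es; path_tac.
  - by rewrite lx.
have tooshort Q' : {subset Q' <= Q} -> uniq Q' -> Q' != [::] ->
    path D a (rcons Q' r) -> m + size Q' < n -> False.
  move=> sQ uQ' n0 aQ' lt.
  have uPQ : uniq (c ++ Q').
    by rewrite cat_uniq uc uQ' andbT; apply/hasPn => y /sQ /QC.
  apply: (@no_between (m + size Q') _ (r :: s ++ Q')).
  - by case: Q' n0 {sQ uQ' aQ' uPQ} lt => //= y Q' _ lt; vlia.
  - by rewrite (@perm_uniq _ _ (c ++ Q')) //; perm_lia.
  - by rewrite cycle_catE rs -aE.
  - by have := psize pE; rewrite /= size_cat sc; vlia.
have uCQ : uniq (c ++ Q) by rewrite cat_uniq uc uQ andbT; apply/hasPn => y /QC.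
have szCQ : m + size Q <= n.
  have [t [sp _ _]] := spanning_complement uCQ.
  by have := spanning_size sp; rewrite !size_cat sc; vlia.
have szQ : m + size Q = n.
  apply/eqP; rewrite eqn_leq szCQ leqNgt; apply/negP => lt.
  exact: (tooshort Q).
have sp : spanning (c ++ Q) by apply: spanningP; rewrite // size_cat sc.
have Qge3 : 3 <= size Q by move: m_le szQ; vlia.
have out z y : z \in c -> y \in s1 -> ~~ D z y.
  move=> zc ys; apply/negP => zy.
  have [s3 [s4 Es]] : exists s3 s4, s1 = s3 ++ y :: s4.
    by case/splitPr: ys => s3 s4; exists s3, s4.
  have sub : {subset y :: s4 <= Q}.
    by move=> w wQ; rewrite /Q Es inE mem_cat wQ !orbT.
  have u4 : uniq (y :: s4) by move: uQ; rewrite /Q Es /= cat_uniq => /and4P[].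
  have p4 : path D z (rcons (y :: s4) r) by move: aQr; rewrite /Q Es; path_tac.
  have [za|za] := eqVneq z (last r s); last exact: (mk z (y :: s4)).
  apply: (tooshort (y :: s4)) => //; first by rewrite aE -za.
  by move: szQ; rewrite /Q Es /= size_cat /=; vlia.
have inn z y : z \in c -> y \in belast q s1 -> ~~ D y z.
  move=> zc ys; apply/negP => yz.
  have [s3 [s4 Es]] : exists s3 s4, belast q s1 = s3 ++ y :: s4.
    by case/splitPr: ys => s3 s4; exists s3, s4.
  have EQ : Q = rcons s3 y ++ rcons s4 (last q s1).
    by rewrite /Q lastI Es -!cats1 -!catA.
  have sub : {subset rcons s3 y <= Q} by move=> w wQ; rewrite EQ mem_cat wQ.
  have u4 : uniq (rcons s3 y) by move: uQ; rewrite EQ cat_uniq => /and3P[].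
  have p4 : path D a (rcons (rcons s3 y) z) by move: aQr; rewrite EQ; path_tac.
  have n4 : rcons s3 y != [::] by case: (s3).
  have [zr|zr] := eqVneq z r; last exact: (mk2 z (rcons s3 y)).
  apply: (tooshort (rcons s3 y)) => //; first by rewrite -zr.
  by move: szQ; rewrite EQ size_cat !size_rcons; vlia.
have [v2 [Q3 [E1 Q3n]]] : exists v2 Q3, s1 = v2 :: Q3 /\ Q3 != [::].
  by move: Qge3; rewrite /Q; case: (s1) => // v2 [|v3 Q3] // _; exists v2, (v3 :: Q3).
have v2s : v2 \in s1 by rewrite E1 mem_head.
have v2b : v2 \in belast q s1.
  by rewrite E1; case: Q3 Q3n {E1} => // v3 Q3 _; rewrite /= !inE eqxx orbT.
have v2Q : v2 \in Q by rewrite /Q inE v2s orbT.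
have v2c : v2 \notin c by apply: QC.
have nav z : z \in c -> na v2 z.
  move=> zc; rewrite naE inn // out // !andbT.
  by apply: contraNneq v2c => ->.
have deg2 : deg D v2 <= 2 * (size Q).-1.
  rewrite (degE D v2 sp) dg_cat [dg v2 c]dg0; last by move=> y /nav /na_ac.
  by apply: dg_mem_le.
have degc z : z \in c -> deg D z <= 2 * m.-1 + 2.
  move=> zc; rewrite (degE D z sp) dg_cat.
  have dz := dg_mem_le D_loopless zc; rewrite sc in dz.
  have o1 : oc z Q <= 1.
    rewrite /Q oc_cons; have -> : oc z s1 = 0; last by rewrite addn0 leq_b1.
    by apply/eqP; rewrite -leqn0 leqNgt -has_count; apply/hasPn => y; apply: out.
  have i1 : ic z Q <= 1.
    rewrite /Q lastI -cats1 ic_cat ic_cons [ic z [::]]/= addn0.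
    have -> : ic z (belast q s1) = 0; last by rewrite add0n leq_b1.
    by apply/eqP; rewrite -leqn0 leqNgt -has_count; apply/hasPn => y; apply: inn.
  by move: dz o1 i1; rewrite /dg; vlia.
(* The bounds are [2(size Q - 1)] for [v2] and [2(m - 1) + 2] for [z], which has at most two arcs
   with [Q]; they sum to [2n - 2]. *)
have badc z : z \in c -> bad D v2 z.
  move=> zc; rewrite /bad nav //=; have := degc z zc.
  by move: deg2 szQ Qge3 m_ge2; vlia.
case: c sc uc badc m_ge2 {cc y0c z0c ac0 qc hp QC rc E pE splitC mk mk2 tooshort uCQ sp out inn v2c nav degc s1c}
  => [|c1 [|c2 c]] /= sc; try by rewrite -sc.
rewrite inE negb_or => /andP[/andP[c12 _] _] badc _.
have b1 := badc c1 (mem_head _ _).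
have b2 : bad D v2 c2 by apply: badc; rewrite !inE eqxx orbT.
by have /eqP := bad_unique D_cond b1 b2; rewrite eq_sym (negbTE c12).
Qed.

End ManyOutside.

(** * Existence of short cycles and the theorem *)

Section CycleExistence.

Variables (V : finType) (D : rel V).

Local Notation oc := (oc D).
Local Notation dg := (dg D).
Local Notation ac := (ac D).
Local Notation n := #|V|.

Hypothesis D_loopless : irreflexive D.
Hypothesis D_cond : triple_degree_condition D.
Hypothesis D_strong : strongly_connected D.
Hypothesis n_ge4 : 4 <= n.

Lemma path_to x y : x != y ->
  exists p, [/\ path D x p, last x p = y, uniq (x :: p) & p != [::]].
Proof.
move=> xy; have /connectP[p0 xp0 lp0] := D_strong xy.
case: (shortenP xp0) lp0 => p xp up _ lp; exists p; split=> //.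
by apply: contraNneq xy => p0E; rewrite lp p0E.
Qed.

(** If all cycles were Hamiltonian, a second out- or in-neighbour would be a chord cutting off a
    shorter cycle. So in- and out-degrees would be at most 1, and the condition would read
    [3n - 2 <= 6]. *)
Lemma short_cycle_exists : (forall k, 2 <= k < n -> no_cycle D k) -> False.
Proof.
move=> no.
have full c : uniq c -> cycle D c -> 2 <= size c -> spanning c.
  move=> uc cc sc; apply: spanningP => //.
  have [t [sp _ _]] := spanning_complement uc.
  have := spanning_size sp; rewrite size_cat => szt.
  have [lt|ge] := ltnP (size c) n; last by move: szt ge; vlia.
  have lt2 : 2 <= size c < n by rewrite sc.
  by case: (no _ lt2 c uc cc).
have Dne x y : D x y -> x != y.
  by move=> xy; apply: contraTneq xy => ->; rewrite D_loopless.
have out1 x : outdeg D x <= 1.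
  apply/card_le1_eqP => y y'; rewrite !inE => xy xy'; apply/eqP; apply: contraT => yy'.
  have [|p [yp lp up p0]] := @path_to y x; first by rewrite eq_sym Dne.
  have sp : spanning (y :: p).
    by apply: full; rewrite //= ?rcons_path ?yp ?lp //; case: (p) p0.
  have : y' \in p.
    by have := spanning_mem y' sp; rewrite inE (negbTE yy').
  move=> /splitPr y'p; case: y'p yp lp up sp p0 => p1 p2 yp lp up sp p0.
  have szp := spanning_size sp; rewrite /= size_cat /= in szp.
  rewrite last_cat /= in lp.
  have p2n : 0 < size p2.
    by case: p2 lp {yp up sp p0 szp} => //= E; rewrite -E D_loopless in xy'.
  exfalso; apply: (no (size (y' :: p2)) _ (y' :: p2)) => //=.
  - by move: szp p2n; vlia.
  - by move: up; rewrite /= cat_uniq => /and4P[_ _ _].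
  - by move: yp; rewrite cat_path /= rcons_path lp xy' => /and3P[_ _ ->].
have in1 x : indeg D x <= 1.
  apply/card_le1_eqP => y y'; rewrite !inE => yx y'x; apply/eqP; apply: contraT => yy'.
  have [|p [xp lp up p0]] := @path_to x y; first by rewrite eq_sym Dne.
  have sp : spanning (x :: p).
    by apply: full; rewrite //= ?rcons_path ?xp ?lp //; case: (p) p0.
  have : y' \in p.
    by have := spanning_mem y' sp; rewrite inE (negbTE (Dne _ _ y'x)).
  move=> /splitPr y'p; case: y'p xp lp up sp p0 => p1 p2 xp lp up sp p0.
  have szp := spanning_size sp; rewrite /= size_cat /= in szp.
  rewrite last_cat /= in lp.
  have p2n : 0 < size p2.
    by case: p2 lp {xp up sp p0 szp} => //= E; rewrite E eqxx in yy'.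
  exfalso; apply: (no (size (x :: rcons p1 y')) _ (x :: rcons p1 y')) => //=; rewrite ?size_rcons.
  - by move: szp p2n; vlia.
  - by move: up; rewrite -cat_rcons -cat_cons cat_uniq => /and3P[].
  - by move: xp; rewrite -cat_rcons cat_path !rcons_path last_rcons y'x => /andP[->].
have /card_gt0P[x _] : 0 < n by move: n_ge4; vlia.
have [s [sp us ms]] := spanning_complement (isT : uniq [:: x]).
have szs := spanning_size sp; rewrite /= in szs.
have degx : deg D x <= 2 by rewrite /deg; have := out1 x; have := in1 x; vlia.
have [/hasP[y ys /eqP xy0]|/hasPn nz] := boolP (has (fun y => ac x y == 0) s); last first.
  have : size s <= dg x s.
    elim: {sp us ms szs} s nz => // y s IHs nz; rewrite dg_cons /=.
    have := nz y (mem_head _ _); rewrite -lt0n.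
    have := IHs (fun z zs => nz z (mem_behead (s := y :: s) zs)).
    by vlia.
  move: degx; rewrite (degE D x sp) /= dg_cons.
  by move: n_ge4 szs; vlia.
have xy : x != y by move: ys; rewrite ms inE eq_sym.
have nxy := ac_na xy xy0.
have [s' ps] := perm_to ys; have szs' := psize ps.
have [/hasP[z zs nxz]|/hasPn allz] := boolP (has (fun z => ~~ D x z) s').
  have zx : z != x.
    have : z \in s by rewrite (perm_mem ps) inE zs orbT.
    by rewrite ms inE.
  have zy : z != y.
    have := perm_uniq ps; rewrite us /= => /esym /andP[ys' _].
    by apply: contraNneq ys' => <-.
  have := cond_out D_cond nxy zx zy nxz; rewrite /deg.
  have := out1 x; have := out1 y; have := in1 x; have := in1 y; have := in1 z.
  by move: n_ge4; vlia.
have : size s' <= oc x s'.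
  suff : all (D x) s' by rewrite all_count => /eqP <-.
  by apply/allP => z /allz; rewrite negbK.
have := out1 x; rewrite (outdegE D x sp) oc_cat (oc_perm D x ps) oc_cons.
by move: szs szs' n_ge4; rewrite /=; vlia.
Qed.

Definition has_cycleb k := [exists t : k.-tuple V, uniq t && cycle D t].

Lemma has_cycleP k : reflect (exists c, [/\ uniq c, cycle D c & size c = k]) (has_cycleb k).
Proof.
apply: (iffP existsP) => [[t /andP[ut ct]]|[c [uc cc sc]]].
  by exists t; rewrite ut ct size_tuple.
by exists (tcast sc (in_tuple c)); rewrite val_tcast /= uc cc.
Qed.

Lemma pre_hamiltonian_or_bipartition :
  (exists c, [/\ uniq c, cycle D c & size c = n.-1]) \/ balanced_bipartition D.
Proof.
have [/has_cycleP|npre] := boolP (has_cycleb n.-1); first by left.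
right; have no_pre : no_cycle D n.-1.
  by move=> c uc cc sc; case/has_cycleP: npre; exists c.
(* Lengths [n - 1] and [n] stay out of the maximum: the former is absent by assumption, the latter
   may occur. *)
pose A k := [&& 2 <= k, k.+2 <= n & has_cycleb k].
have exA : exists k, A k.
  have [/hasP[k _ Ak]|/hasPn nA] := boolP (has A (iota 0 n)); first by exists k.
  case: short_cycle_exists => k /andP[k2 kn] c uc cc sc.
  have kA : k \in iota 0 n by rewrite mem_iota.
  have := nA k kA; rewrite /A k2 /= negb_and.
  have hc : has_cycleb k by apply/has_cycleP; exists c.
  rewrite hc orbF -ltnNge => lt.
  by apply: (no_pre c uc cc); move: lt kn sc; vlia.
have boundA k : A k -> k <= n by case/and3P=> _ kn _; move: kn; vlia.
case: (ex_maxnP exA boundA) => m /and3P[m2 mn /has_cycleP[c [uc cc sc]]] maxm.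
have no_between k : m < k < n -> no_cycle D k.
  move=> /andP[mk kn] c' uc' cc' sc'.
  have [E|neq] := eqVneq k n.-1; first by apply: (no_pre c'); rewrite // sc'.
  have : A k.
    rewrite /A; apply/and3P; split; first by move: m2 mk; vlia.
      by move: neq kn; case: ltngtP => //; vlia.
    by apply/has_cycleP; exists c'.
  by move/maxm; move: mk; vlia.
have [E|ne] := eqVneq (m + 2) n.
  have [t [sp _ _]] := spanning_complement uc.
  have := spanning_size sp; rewrite size_cat sc -E => /eqP; rewrite eqn_add2l.
  case: t sp => [|v [|w []]] // sp _.
  apply: (misses_bipartition D_loopless D_cond D_strong n_ge4 no_pre (c := c) (v := v) (w := w)).
  by split=> //; span_lia.
case: (no_short_longest_cycle D_loopless D_cond D_strong m2 _ no_between uc cc sc).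
by move: mn ne; case: ltngtP => //; vlia.
Qed.

Lemma balanced_bipartition_iso : balanced_bipartition D ->
  ~~ odd n /\ digraph_iso D (@Kstar n./2 n./2).
Proof.
case=> A [cA DE]; have cn : #|A| + #|A| = n by rewrite {2}cA cardsC.
have on : ~~ odd n by rewrite -cn addnn odd_double.
have hA : #|A| = n./2 by rewrite -cn addnn doubleK.
have hB : #|~: A| = n./2 by rewrite -cA.
split=> //; have /card_gt0P[a0 a0A] : 0 < #|A| by move: cn n_ge4; vlia.
have /card_gt0P[b0 b0A] : 0 < #|~: A| by move: cn cA n_ge4; vlia.
pose f x : 'I_n./2 + 'I_n./2 :=
  if x \in A then inl (cast_ord hA (enum_rank_in a0A x))
  else inr (cast_ord hB (enum_rank_in b0A x)).
exists f; split.
  apply: inj_card_bij; last by rewrite card_sum !card_ord -hA cn.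
  move=> x y; rewrite /f; case: ifP => xA; case: ifP => yA //.
    by case=> /ord_inj/enum_rank_in_inj; apply.
  case=> /ord_inj/enum_rank_in_inj; apply; by rewrite in_setC ?xA ?yA.
move=> x y; rewrite DE /f; by case: (x \in A); case: (y \in A).
Qed.

End CycleExistence.

Theorem theorem1p10 (V : finType) (D : rel V) (n : nat)
    (card_V : #|V| = n) (n_ge4 : 4 <= n)
    (D_loopless : irreflexive D)
    (D_strong : strongly_connected D)
    (D_cond : triple_degree_condition D) :
  has_cycle_of_length D (n - 1) \/
  (~~ odd n /\ digraph_iso D (@Kstar n./2 n./2)).
Proof.
subst n.
have [[c [uc cc sc]]|bip] :=
  pre_hamiltonian_or_bipartition D_loopless D_cond D_strong n_ge4.
  by left; exists c; rewrite subn1 /ucycle cc uc.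
by right; apply: balanced_bipartition_iso.
Qed.
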